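(* Let $P$ be a real $n\times n$ orthoprojector matrix (i.e. $P=P^T=P^2$) and $r=\operatorname{rank}P$. Let $\epsilon=(\epsilon_1,\dots,\epsilon_n)^T$, where $\epsilon_1,\dots,\epsilon_n$ are independent with $\mathbf P(\epsilon_i=1)=\mathbf P(\epsilon_i=-1)=\frac12$. Then for every $f\in C^2_{conv}$ $$\mathbf E f((\epsilon^TP\epsilon)^{1/2})\le\mathbf E f(\chi_r).$$ If, moreover, $f\in C^2_{\uparrow,conv}$, then also $$\mathbf E f((\eta^TP\eta)^{1/2})\le\mathbf E f(\chi_r)$$ for every $\eta=(\eta_1,\dots,\eta_n)^T$ with independent random variables $\eta_i$ such that $\mathbf E\eta_i=0$ and $|\eta_i|\le1$ with probability $1$.
   Context: $C^2_{conv}$ is the class of all even functions $f:\mathbb R\to\mathbb R$ having a finite and convex second derivative $f''$ on $\mathbb R$. $C^2_{\uparrow,conv}$ is the class of all $f\in C^2_{conv}$ with $f(0)\ge0$ and $f''(0)\ge0$. $\chi_r$ is the nonnegative square root of a random variable having the chi-square distribution with $r$ degrees of freedom ($\chi_0=0$). The right-hand sides may be $+\infty$. *)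

(* Defs.v *)
From HB Require Import structures.
From mathcomp Require Import all_boot all_order all_algebra.
From mathcomp Require Import all_classical all_reals all_analysis.
From mathcomp Require Import measurable_realfun.

Set Implicit Arguments.
Unset Strict Implicit.
Unset Printing Implicit Defensive.

Import Order.TTheory GRing.Theory Num.Theory.
Import numFieldNormedType.Exports.

Local Open Scope classical_set_scope.
Local Open Scope ring_scope.

Definition orthoprojector (R : realType) (n : nat) (M : 'M[R]_n) : Prop :=
  M^T = M /\ M *m M = M.

Definition quad_form (R : realType) (n : nat) (M : 'M[R]_n) (v : 'cV[R]_n) : R :=
  (v^T *m M *m v) 0 0.

(* The derivative operators of the library are total functions, so that the
   existence of f' and f'' is required separately. *)
Definition C2_conv (R : realType) (f : R -> R) : Prop :=
  [/\ forall x : R, f (- x) = f x,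
      forall x : R, derivable f x 1,
      forall x : R, derivable (f^`())%classic x 1
    & convex_function ([set: R] : set R^o) (f^`(2))%classic].

Definition C2_up_conv (R : realType) (f : R -> R) : Prop :=
  [/\ C2_conv f, 0 <= f 0 & 0 <= (f^`(2))%classic 0].

Definition mutually_independent (d : measure_display) (T : measurableType d)
    (R : realType) (P : probability T R) (I : finType)
    (X : I -> {RV P >-> R}) : Prop :=
  forall (J : {set I}) (B : I -> set R),
    (forall i, i \in J -> measurable (B i)) ->
    P (\bigcap_(i in [set` J]) (X i @^-1` B i)) =
    (\prod_(i in J) P (X i @^-1` B i))%E.

Definition rademacher (d : measure_display) (T : measurableType d)
    (R : realType) (P : probability T R) (X : {RV P >-> R}) : Prop :=
  P (X @^-1` [set 1]) = (2^-1)%:E /\ P (X @^-1` [set -1]) = (2^-1)%:E.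

Definition add_square (R : realType)
    (p : measurableTypeR R * measurableTypeR R) : measurableTypeR R :=
  p.1 + p.2 ^+ 2.

Lemma measurable_add_square (R : realType) :
  measurable_fun [set: measurableTypeR R * measurableTypeR R] (@add_square R).
Proof.
apply: measurable_funD; first exact: measurable_fst.
by apply: measurable_funX; exact: measurable_snd.
Qed.

HB.instance Definition _ (R : realType) :=
  isMeasurableFun.Build _ _ _ _ (@add_square R) (@measurable_add_square R).

(* The law of Z_1 ^+ 2 + ... + Z_r ^+ 2 for independent standard normal
   Z_1, ..., Z_r: the step adds to a variable with r degrees of freedom the
   square of an independent standard normal one. *)
Fixpoint chi_square_prob (R : realType) (r : nat) :
    probability (measurableTypeR R) R :=
  if r is r'.+1 then
    distribution (chi_square_prob R r' \x normal_prob 0 1)%E (@add_square R)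
  else @dirac _ (measurableTypeR R) 0 R.

Definition chi_square_distributed (d : measure_display) (T : measurableType d)
    (R : realType) (P : probability T R) (r : nat) (X : {RV P >-> R}) : Prop :=
  forall A : set R, measurable A -> distribution P X A = chi_square_prob R r A.

(* Main.v *)
Require Import Defs.
From HB Require Import structures.
From mathcomp Require Import all_boot all_order all_algebra.
From mathcomp Require Import all_classical all_reals all_analysis.
From mathcomp Require Import measurable_realfun.
From mathcomp Require Import ring lra.

Set Implicit Arguments.
Unset Strict Implicit.
Unset Printing Implicit Defensive.

Import Order.TTheory GRing.Theory Num.Theory.
Import numFieldNormedType.Exports.

Local Open Scope classical_set_scope.
Local Open Scope ring_scope.

(** The quadratic form of an orthoprojector [M] at a vector is the squared length
    of the image of that vector, and this image is the sum of the columns of [M]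
    weighted by the coordinates. The coordinates are replaced one at a time by
    independent standard normal variables, which increases the mean, and the
    length of the Gaussian vector so obtained is then identified.

    Replacement. On a line, [f] of the length is a function of the form
    [phi t = f (sqrt (q + t ^+ 2))]. If [f''] is nonnegative then [f] is convex,
    and nondecreasing on nonnegative numbers, so [phi] is convex
    ([radial_chord]); a centred variable with values in the interval [-1, 1] can
    therefore be replaced by a random sign. The step from a sign to a normal
    variable uses the convexity of [f'']: it makes [phi (b + s) + phi (b - s)] a
    convex function of [s ^+ 2] ([radial_square_tangent]), and the squares of both
    variables have mean one, so that Jensen's inequality applies
    ([gauss_tangent]). With [k r = f' r / r], convexity in [s ^+ 2] reduces to the
    inequality [radial_key], in which two facts about the convex [f''] are
    used: the trapezoid bound for its integral ([trapezoid]) and the monotonicity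
    of [(f'' r - k r) / r] ([derivative_gap_mono]). Both replacements together
    define the class [two_point] of functions of a vector. This class is stable
    under averaging over a Gaussian displacement ([two_point_gauss_avg]), so the
    replacement can be iterated ([integral_sum_le]), each step using only the
    independence of one variable from the preceding ones
    ([ge0_integral_indep]).

    Identification. The standard normal law in the plane is invariant under
    rotations ([normal_rotation]), because a rotation is a product of three
    shears. Hence the mean of a function of a Gaussian combination of vectors [x]
    does not change when two of the vectors are rotated into each other, which
    leaves the sum of the matrices [x *m x^T] unchanged ([gauss_avgs_align]). For
    the columns of [M] this sum is [M], and rotating them onto an orthonormal basis
    of the range of [M] exhibits the squared length as the sum of the squares of
    [\rank M] independent standard normal variables ([gauss_avgs_chi_square]).

    Random signs. A general even [f] with convex [f''] is the sum of a function as
    above and of [f 0 + c * x ^+ 2] for some [c <= 0] ([C2_conv_split]). The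
    quadratic part has the same mean on both sides: the comparison itself, for the
    squared length, bounds the mean of the quadratic form of [M] by [\rank M], and
    likewise for the complementary projector, whereas the two forms add up to the
    squared length of a vector of signs, which is [n]
    ([rank_le_quad_form_mean]). *)

(** * Real functions of one variable *)

Section scalar_derivatives.
Context {R : realType}.
Implicit Types (F G dF : R -> R) (a b x d e : R).

Lemma is_deriveD1 F G x d e : is_derive x 1 F d -> is_derive x 1 G e ->
  is_derive x 1 (fun t => F t + G t) (d + e).
Proof. by move=> dF dG; exact: is_deriveD. Qed.

Lemma is_deriveM1 F G x d e : is_derive x 1 F d -> is_derive x 1 G e ->
  is_derive x 1 (fun t => F t * G t) (F x * e + d * G x).
Proof.
by move=> dF dG; apply: is_derive_eq (is_deriveM dF dG) _; rewrite (mulrC d).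
Qed.

Lemma is_derive_comp1 F G x d e : is_derive (G x) 1 F d -> is_derive x 1 G e ->
  is_derive x 1 (fun t => F (G t)) (d * e).
Proof. exact: is_derive1_comp. Qed.

Lemma is_deriveZ1 a F x d : is_derive x 1 F d ->
  is_derive x 1 (fun t => a * F t) (a * d).
Proof. exact: is_deriveZ. Qed.

Lemma is_derive_affine a b x : is_derive x 1 (fun t => a + b * t) b.
Proof.
apply: is_derive_eq (is_deriveD1 (is_derive_cst a x 1)
  (is_deriveM1 (is_derive_cst b x 1) (is_derive_id x 1))) _.
by rewrite mulr1 mul0r addr0 add0r.
Qed.

Lemma is_derive_quadratic a b x :
  is_derive x 1 (fun t => a + b * t ^+ 2) (2 * b * x).
Proof.
have dX : is_derive x 1 (fun t : R => t ^+ 2) (2 * x).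
  by apply: is_derive_eq (is_deriveM1 (is_derive_id x 1) (is_derive_id x 1)) _ => /=; ring.
apply: is_derive_eq (is_deriveD1 (is_derive_cst a x 1)
  (is_deriveM1 (is_derive_cst b x 1) dX)) _ => /=; ring.
Qed.

Lemma is_derive_affine_comp F dF a b x : (forall t : R, is_derive t 1 F (dF t)) ->
  is_derive x 1 (fun t => F (a + b * t)) (b * dF (a + b * x)).
Proof.
move=> dFE.
by apply: is_derive_eq (is_derive_comp1 (dFE _) (is_derive_affine a b x)) _; ring.
Qed.

Lemma mean_value F dF a b : a <= b ->
  (forall x, a <= x <= b -> is_derive x 1 F (dF x)) ->
  exists2 c, a <= c <= b & F b - F a = dF c * (b - a).
Proof.
move=> ab dFE.
have [||c + Fc] := @MVT_segment R F dF a b ab.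
- by move=> x /[!in_itv]/= /andP[ax xb]; apply: dFE; rewrite !ltW.
- apply: derivable_within_continuous => x /[!in_itv]/= xab.
  by have [] := dFE x xab.
by rewrite in_itv/= => cab; exists c.
Qed.

Lemma nondecreasing_of_derive F dF a b : a <= b ->
  (forall x, a <= x <= b -> is_derive x 1 F (dF x)) ->
  (forall x, a <= x <= b -> 0 <= dF x) -> F a <= F b.
Proof.
move=> ab dFE dF0; have [c cab Fc] := mean_value ab dFE.
by rewrite -subr_ge0 Fc mulr_ge0 ?dF0 ?subr_ge0.
Qed.

Lemma nonincreasing_of_derive F dF a b : a <= b ->
  (forall x, a <= x <= b -> is_derive x 1 F (dF x)) ->
  (forall x, a <= x <= b -> dF x <= 0) -> F b <= F a.
Proof.
move=> ab dFE dF0; have [c cab Fc] := mean_value ab dFE.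
by rewrite -subr_le0 Fc mulr_le0_ge0 ?dF0 ?subr_ge0.
Qed.

(** The hypotheses make the quotient [dF x / x] nondecreasing, which means that [F]
    is a convex function of the square of its argument; it lies above its tangent
    in that variable. *)
Lemma square_tangent F dF d2F a : 0 < a ->
  (forall x, 0 <= x -> is_derive x 1 F (dF x)) ->
  (forall x, 0 < x -> is_derive x 1 dF (d2F x)) ->
  dF 0 = 0 -> (forall x, 0 < x -> dF x <= x * d2F x) ->
  exists k, forall x, 0 <= x -> F a + k * (x ^+ 2 - a ^+ 2) <= F x.
Proof.
move=> a0 dFE d2FE dF00 dFle.
pose Q x := dF x * x^-1.
have Qmono x y : 0 < x -> x <= y -> Q x <= Q y.
  move=> x0 xy.
  apply: (@nondecreasing_of_derive Q
    (fun z => dF z * - (z ^- 2) + d2F z * z^-1) x y) => // z /andP[xz zy].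
    have z0 : 0 < z := lt_le_trans x0 xz.
    have dV : is_derive z 1 (fun t : R => t^-1) (- (z ^- 2)).
      have zN0 : idfun z != 0 by rewrite gt_eqF.
      by apply: is_derive_eq (is_deriveV zN0 (is_derive_id z 1)) _; rewrite scaler1.
    exact: is_deriveM1 (d2FE _ z0) dV.
  have z0 : 0 < z := lt_le_trans x0 xz.
  have -> : dF z * - (z ^- 2) + d2F z * z^-1 = (z * d2F z - dF z) * z ^- 2.
    by field; rewrite gt_eqF.
  by rewrite mulr_ge0 ?subr_ge0 ?dFle// invr_ge0 exprn_ge0 ?ltW.
have QE x : 0 <= x -> dF x = Q x * x.
  rewrite le_eqVlt => /predU1P[<-|x0]; first by rewrite dF00 mulr0.
  by rewrite /Q divfK// gt_eqF.
(* the derivative of [F] minus the parabola changes sign only at [a] *)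
pose W x := F x + (- (Q a / 2)) * x ^+ 2.
have dW x : 0 <= x -> is_derive x 1 W (dF x - Q a * x).
  move=> x0; have d2 := is_derive_quadratic 0 (- (Q a / 2)) x.
  have := is_deriveD1 (dFE x x0) d2.
  under eq_fun do rewrite add0r.
  by move=> /is_derive_eq; apply; field.
exists (Q a / 2) => x x0.
suff : W a <= W x by rewrite /W; lra.
have [xa|/ltW ax] := leP x a.
  apply: (@nonincreasing_of_derive W _ x a xa).
    by move=> z /andP[xz _]; apply: dW; exact: le_trans xz.
  move=> z /andP[xz za]; rewrite QE ?(le_trans x0 xz)//.
  have := le_trans x0 xz; rewrite le_eqVlt => /predU1P[<-|z0].
    by rewrite !mulr0 subrr.
  by rewrite -mulrBl mulr_le0_ge0 ?subr_le0 ?(ltW z0)// Qmono.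
apply: (@nondecreasing_of_derive W _ a x ax).
  by move=> z /andP[az _]; apply: dW; rewrite (le_trans _ az)// ltW.
move=> z /andP[az zx]; have z0 : 0 < z := lt_le_trans a0 az.
by rewrite QE ?(ltW z0)// -mulrBl mulr_ge0 ?(ltW z0)// subr_ge0 Qmono.
Qed.

End scalar_derivatives.

(** * Even functions with a convex second derivative *)

Section key_inequality.
Context {R : realFieldType}.

(** The [t i / r i] are nondecreasing and [(t1 + t2) / (r1 + r2)] is their
    mediant, so it is below the second of them, while convexity of the square
    bounds the square of the mediant by the weighted mean of the squares. *)
Lemma mediant_square_le (r1 r2 t1 t2 u1 u2 : R) :
  0 < r1 -> 0 < r2 -> 0 <= t1 -> 0 <= t2 -> t1 * r2 <= t2 * r1 ->
  0 <= u1 -> u1 <= u2 ->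
  ((t1 + t2) / (r1 + r2)) ^+ 2 * (r1 * u1 + r2 * u2)
    <= u1 * (t1 ^+ 2 / r1) + u2 * (t2 ^+ 2 / r2).
Proof.
move=> r10 r20 t10 t20 trl u10 u12.
have rr0 : 0 < r1 + r2 by rewrite addr_gt0.
have tau2 : ((t1 + t2) / (r1 + r2)) ^+ 2 * r2 <= t2 ^+ 2 / r2.
  rewrite ler_pdivlMr// -mulrA -expr2 -exprMn ler_sqr ?nnegrE//; last first.
    by rewrite mulr_ge0 ?divr_ge0 ?addr_ge0 ?(ltW r10) ?(ltW r20).
  rewrite mulrAC ler_pdivrMr//; nra.
have tauD : ((t1 + t2) / (r1 + r2)) ^+ 2 * (r1 + r2) <= t1 ^+ 2 / r1 + t2 ^+ 2 / r2.
  have -> : ((t1 + t2) / (r1 + r2)) ^+ 2 * (r1 + r2) = (t1 + t2) ^+ 2 / (r1 + r2).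
    by field; rewrite gt_eqF.
  rewrite -subr_ge0.
  have -> : t1 ^+ 2 / r1 + t2 ^+ 2 / r2 - (t1 + t2) ^+ 2 / (r1 + r2)
      = (t1 * r2 - t2 * r1) ^+ 2 / (r1 * r2 * (r1 + r2)).
    by field; rewrite !gt_eqF.
  by rewrite divr_ge0 ?sqr_ge0// ltW// !mulr_gt0.
have u210 : 0 <= u2 - u1 by rewrite subr_ge0.
move: (ler_wpM2l u10 tauD) (ler_wpM2l u210 tau2); lra.
Qed.

(** Here [r1] and [r2] are the distances from the origin of the points with
    abscissae [b - s] and [b + s] on a line at squared distance [q], and the
    hypotheses on [k] and [y] are those met by [k r = f' r / r] and
    [y r = f'' r - k r]. As [r2 - r1 = 4 * b * s / (r1 + r2)], the last of them
    bounds the left side by a multiple of [(2 * b / (r1 + r2)) ^+ 2], which is at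
    most the square of the mediant in [mediant_square_le]. *)
Lemma radial_key (q b s r1 r2 k1 k2 y1 y2 : R) : 0 < q -> 0 <= b -> 0 <= s ->
  0 < r1 -> 0 < r2 -> r1 ^+ 2 = q + (b - s) ^+ 2 -> r2 ^+ 2 = q + (b + s) ^+ 2 ->
  0 <= y1 -> r2 * y1 <= r1 * y2 ->
  (r1 + r2) * (k2 - k1) <= (r2 - r1) * (y1 + y2) ->
  b * (k2 - k1) <=
    s * (y1 * (b - s) ^+ 2 / r1 ^+ 2 + y2 * (b + s) ^+ 2 / r2 ^+ 2).
Proof.
move=> q0 b0 s0 r10 r20 r1E r2E y10 y12 kle.
have rr0 : 0 < r1 + r2 by rewrite addr_gt0.
have bs0 : 0 <= b * s by rewrite mulr_ge0.
have r12 : r1 <= r2.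
  rewrite -ler_sqr ?nnegrE ?(ltW r10) ?(ltW r20)// -subr_ge0 r1E r2E.
  have -> : q + (b + s) ^+ 2 - (q + (b - s) ^+ 2) = 4 * (b * s) by ring.
  by rewrite mulr_ge0.
(* the modulus handles [s <= b] and [b <= s] at once *)
pose t1 := `|b - s|; pose t2 := b + s.
have t10 : 0 <= t1 by rewrite normr_ge0.
have t20 : 0 <= t2 by rewrite addr_ge0.
have t1E : t1 ^+ 2 = (b - s) ^+ 2 by rewrite real_normK ?num_real.
have t12 : t1 <= t2 by rewrite /t1 /t2 ler_norml; apply/andP; split; lra.
have trl : t1 * r2 <= t2 * r1.
  rewrite -ler_sqr ?nnegrE ?mulr_ge0 ?(ltW r10) ?(ltW r20)// !exprMn r1E r2E t1E -/t2.
  have : t1 ^+ 2 <= t2 ^+ 2 by rewrite ler_sqr.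
  rewrite t1E -/t2 => /(ler_wpM2l (ltW q0)); lra.
have b2 : 2 * b <= t1 + t2.
  by have := ler_norm (b - s); rewrite -/t1 /t2; lra.
have u10 : 0 <= y1 / r1 by rewrite divr_ge0 ?(ltW r10).
have u12 : y1 / r1 <= y2 / r2.
  by rewrite ler_pdivrMr// mulrAC ler_pdivlMr// mulrC (mulrC y2).
have := mediant_square_le r10 r20 t10 t20 trl u10 u12.
rewrite [r1 * _]mulrC [r2 * (y2 / _)]mulrC !divfK ?gt_eqF//.
have -> : y1 / r1 * (t1 ^+ 2 / r1) + y2 / r2 * (t2 ^+ 2 / r2) =
    y1 * (b - s) ^+ 2 / r1 ^+ 2 + y2 * (b + s) ^+ 2 / r2 ^+ 2.
  by rewrite t1E /t2; field; rewrite !gt_eqF.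
move=> med; apply: le_trans (ler_wpM2l s0 med).
have yy0 : 0 <= y1 + y2.
  have : 0 <= y2 by rewrite -(pmulr_rge0 _ r10) (le_trans _ y12)// mulr_ge0// (ltW r20).
  exact: addr_ge0.
have kle' : k2 - k1 <= 4 * b * s / (r1 + r2) ^+ 2 * (y1 + y2).
  have <- : (r2 - r1) / (r1 + r2) = 4 * b * s / (r1 + r2) ^+ 2.
    have -> : 4 * b * s = (r2 - r1) * (r1 + r2).
      transitivity (r2 ^+ 2 - r1 ^+ 2); [rewrite r1E r2E|]; ring.
    by field; rewrite gt_eqF.
  by rewrite mulrAC ler_pdivlMr// mulrC.
apply: le_trans (ler_wpM2l b0 kle') _.
rewrite mulrA (mulrA s) ler_wpM2r// expr_div_n !mulrA.
rewrite ler_wpM2r ?invr_ge0 ?exprn_ge0 ?(ltW rr0)//.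
have : (2 * b) ^+ 2 <= (t1 + t2) ^+ 2 by rewrite ler_sqr ?nnegrE; lra.
by move=> /(ler_wpM2l s0); lra.
Qed.

End key_inequality.

Section smooth_even_convex.
Context {R : realType} (f f1 f2 : R -> R).
Context (f_even : forall x, f (- x) = f x)
  (df : forall x : R, is_derive x 1 f (f1 x))
  (df1 : forall x : R, is_derive x 1 f1 (f2 x))
  (f2_even : forall x, f2 (- x) = f2 x)
  (f1_0 : f1 0 = 0)
  (f2_convex : forall t x y : R, 0 <= t -> t <= 1 ->
     f2 (t * x + (1 - t) * y) <= t * f2 x + (1 - t) * f2 y)
  (f2_0 : 0 <= f2 0).

Lemma second_derivative_mono x y : 0 <= x -> x <= y -> f2 x <= f2 y.
Proof.
move=> x0; rewrite le_eqVlt => /predU1P[->//|xy].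
have y0 : 0 < y := le_lt_trans x0 xy.
(* [x] is a convex combination of [y] and [- y] *)
have yN0 : 2 * y != 0 by rewrite gt_eqF// mulr_gt0.
have := @f2_convex ((x + y) / (2 * y)) y (- y).
have -> : (x + y) / (2 * y) * f2 y + (1 - (x + y) / (2 * y)) * f2 (- y) = f2 y.
  by rewrite f2_even; ring.
have -> : (x + y) / (2 * y) * y + (1 - (x + y) / (2 * y)) * - y = x.
  by field; rewrite gt_eqF.
apply; first by rewrite divr_ge0// ?addr_ge0 ?mulr_ge0 ?(ltW y0).
by rewrite ler_pdivrMr ?mulr_gt0//; lra.
Qed.

Lemma second_derivative_ge0 x : 0 <= f2 x.
Proof.
have [x0|/ltW x0] := leP 0 x.
  by apply: le_trans f2_0 _; exact: second_derivative_mono.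
rewrite -f2_even; apply: le_trans f2_0 _.
by apply: second_derivative_mono; rewrite ?oppr_ge0.
Qed.

(** The Hermite-Hadamard inequality: the mean of a convex function is at most
    the mean of its end values. *)
Lemma trapezoid a b : a <= b -> 2 * (f1 b - f1 a) <= (b - a) * (f2 a + f2 b).
Proof.
move=> ab; pose m := (a + b) / 2; pose h := (b - a) / 2.
have h0 : 0 <= h by rewrite divr_ge0 ?subr_ge0.
pose M u := f1 (m + h * u) + - 1 * f1 (m + - h * u).
have dM (u : R) : is_derive u 1 M (h * f2 (m + h * u) + h * f2 (m + - h * u)).
  apply: is_derive_eq (is_deriveD1 (is_derive_affine_comp m h u df1)
    (is_deriveZ1 (- 1) (is_derive_affine_comp m (- h) u df1))) _.
  by rewrite /=; ring.
have [c /andP[c0 c1] Mc] := @mean_value R M _ 0 1 ler01 (fun u _ => dM u).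
have E0 : m + h * 0 = m + - h * 0 by rewrite !mulr0.
have Eb : m + h * 1 = b by rewrite /m /h; field.
have Ea : m + - h * 1 = a by rewrite /m /h; field.
move: Mc; rewrite /M Eb Ea E0 subr0 mulr1 => Mc.
have fb := @f2_convex ((1 + c) / 2) b a.
have fa := @f2_convex ((1 - c) / 2) b a.
have t1 : (1 + c) / 2 * b + (1 - (1 + c) / 2) * a = m + h * c.
  by rewrite /m /h; field.
have t2 : (1 - c) / 2 * b + (1 - (1 - c) / 2) * a = m + - h * c.
  by rewrite /m /h; field.
rewrite t1 in fb; rewrite t2 in fa.
have s : f2 (m + h * c) + f2 (m + - h * c) <= f2 a + f2 b.
  have := fb _ _; have := fa _ _; lra.
have := ler_wpM2l h0 s.
have -> : b - a = 2 * h by rewrite /h; field.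
lra.
Qed.

Lemma derivative_le x : 0 <= x -> f1 x <= x * f2 x.
Proof.
move=> x0; have [c /andP[c0 cx]] := @mean_value R f1 f2 0 x x0 (fun u _ => df1 u).
rewrite f1_0 !subr0 => ->; rewrite mulrC ler_wpM2l//.
exact: second_derivative_mono.
Qed.

Lemma derivative_mono x y : x <= y -> f1 x <= f1 y.
Proof.
move=> xy; apply: (nondecreasing_of_derive xy (fun u _ => df1 u)) => u _.
exact: second_derivative_ge0.
Qed.

Lemma derivative_ge0 x : 0 <= x -> 0 <= f1 x.
Proof. by move=> x0; rewrite -f1_0 derivative_mono. Qed.

Lemma even_mono x y : 0 <= x -> x <= y -> f x <= f y.
Proof.
move=> x0 xy; apply: (nondecreasing_of_derive xy (fun u _ => df u)).
by move=> u /andP[xu _]; rewrite derivative_ge0 ?(le_trans x0).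
Qed.

(** The difference quotients of the convex [f2] from a point to the same
    fraction of it increase with the point; averaging over the fractions turns
    [f2] at the fraction into [f1]. *)
Lemma derivative_gap_mono a b : 0 < a -> a <= b ->
  b * (f2 a - f1 a / a) <= a * (f2 b - f1 b / b).
Proof.
move=> a0 ab; have b0 : 0 < b := lt_le_trans a0 ab.
pose N u := a / b * f1 (0 + b * u) + - (b / a) * f1 (0 + a * u).
have dN (u : R) : is_derive u 1 N (a * f2 (b * u) - b * f2 (a * u)).
  apply: is_derive_eq (is_deriveD1
    (is_deriveZ1 (a / b) (is_derive_affine_comp 0 b u df1))
    (is_deriveZ1 (- (b / a)) (is_derive_affine_comp 0 a u df1))) _.
  by rewrite /= !add0r; field; rewrite !gt_eqF.
have [c /andP[c0 c1]] := @mean_value R N _ 0 1 ler01 (fun u _ => dN u).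
rewrite /N !add0r !mulr0 f1_0 !mulr0 !mulr1 add0r !subr0 mulr1 => Nc.
suff : a * f2 (b * c) - b * f2 (a * c) <= a * f2 b - b * f2 a.
  rewrite -Nc !mulrBr.
  have -> : a * (f1 b / b) = a / b * f1 b by ring.
  have -> : b * (f1 a / a) = b / a * f1 a by ring.
  lra.
have [c1'|c1'] := eqVneq c 1; first by rewrite c1' !mulr1.
have c1lt : c < 1 by rewrite lt_neqAle c1'.
(* both [a] and [b * c] lie between [a * c] and [b] *)
have acb : a * c < b by nra.
have D0 : 0 < b - a * c by rewrite subr_gt0.
pose t := (a - a * c) / (b - a * c); pose u := (b * c - a * c) / (b - a * c).
have h1 := @f2_convex t b (a * c); have h2 := @f2_convex u b (a * c).
have E1 : t * b + (1 - t) * (a * c) = a by rewrite /t; field; rewrite gt_eqF.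
have E2 : u * b + (1 - u) * (a * c) = b * c.
  by rewrite /u; field; rewrite gt_eqF.
have E3 : b * t + a * u = a by rewrite /t /u; field; rewrite gt_eqF.
have {}h1 : f2 a <= t * f2 b + (1 - t) * f2 (a * c).
  rewrite -[in X in X <= _]E1 h1// ?divr_ge0 ?(ltW D0)//; first nra.
  by rewrite ler_pdivrMr// mul1r lerB.
have {}h2 : f2 (b * c) <= u * f2 b + (1 - u) * f2 (a * c).
  rewrite -[in X in X <= _]E2 h2// ?divr_ge0 ?(ltW D0)//; first nra.
  by rewrite ler_pdivrMr// mul1r lerB//; nra.
have E4 : b * (t * f2 b + (1 - t) * f2 (a * c)) +
    a * (u * f2 b + (1 - u) * f2 (a * c)) = a * f2 b + b * f2 (a * c).
  transitivity ((b * t + a * u) * f2 b + (b + a - (b * t + a * u)) * f2 (a * c)).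
    by ring.
  by rewrite E3; ring.
move: (ler_wpM2l (ltW b0) h1) (ler_wpM2l (ltW a0) h2); lra.
Qed.
Lemma tangent_le m x : f m + f1 m * (x - m) <= f x.
Proof.
have [mx|/ltW xm] := leP m x.
  have [c /andP[mc _]] := mean_value mx (fun u _ => df u).
  have := ler_wpM2r (_ : 0 <= x - m) (derivative_mono mc).
  by rewrite subr_ge0 => /(_ mx); lra.
have [c /andP[_ cm]] := mean_value xm (fun u _ => df u).
have := ler_wpM2r (_ : 0 <= m - x) (derivative_mono cm).
by rewrite subr_ge0 => /(_ xm); lra.
Qed.

(** The values of [f] of the length along a line at squared distance [q] from the
    origin, as a function of the abscissa counted from the foot of the
    perpendicular. *)
Definition radial q t := f (Num.sqrt (q + t ^+ 2)).

Lemma radialN q t : radial q (- t) = radial q t.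
Proof. by rewrite /radial sqrrN. Qed.

(** The length is convex along a line, and [f] is convex and nondecreasing. *)
Lemma radial_chord q b s e : 0 <= q -> `|e| <= 1 ->
  radial q (b + e * s)
    <= (1 + e) / 2 * radial q (b + s) + (1 - e) / 2 * radial q (b - s).
Proof.
move=> q0; rewrite ler_norml => /andP[eN1 e1]; rewrite /radial.
set U := Num.sqrt (q + (b + s) ^+ 2); set W := Num.sqrt (q + (b - s) ^+ 2).
have U0 : 0 <= U by exact: sqrtr_ge0.
have W0 : 0 <= W by exact: sqrtr_ge0.
have UE : U ^+ 2 = q + (b + s) ^+ 2 by rewrite sqr_sqrtr// addr_ge0// sqr_ge0.
have WE : W ^+ 2 = q + (b - s) ^+ 2 by rewrite sqr_sqrtr// addr_ge0// sqr_ge0.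
have t0 : 0 <= (1 + e) / 2 by lra.
have t1 : 0 <= (1 - e) / 2 by lra.
pose V := (1 + e) / 2 * U + (1 - e) / 2 * W.
have V0 : 0 <= V by apply: addr_ge0; apply: mulr_ge0.
(* the Cauchy-Schwarz inequality for the two end points *)
have UW : q + (b + s) * (b - s) <= U * W.
  have [h|/ltW h] := leP (q + (b + s) * (b - s)) 0.
    by rewrite (le_trans h)// mulr_ge0.
  rewrite -ler_sqr ?nnegrE ?mulr_ge0// exprMn UE WE -subr_ge0.
  set d := (X in 0 <= X); have -> : d = q * (2 * s) ^+ 2 by rewrite /d; ring.
  by rewrite mulr_ge0// sqr_ge0.
have leV : Num.sqrt (q + (b + e * s) ^+ 2) <= V.
  rewrite -(ger0_norm V0) -sqrtr_sqr ler_wsqrtr// -subr_ge0.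
  have -> : V ^+ 2 - (q + (b + e * s) ^+ 2) =
      (1 + e) / 2 * ((1 - e) / 2) * 2 * (U * W - (q + (b + s) * (b - s))).
    rewrite /V.
    transitivity (((1 + e) / 2) ^+ 2 * U ^+ 2 + ((1 - e) / 2) ^+ 2 * W ^+ 2 +
      2 * ((1 + e) / 2) * ((1 - e) / 2) * (U * W) - (q + (b + e * s) ^+ 2)).
      by ring.
    by rewrite UE WE; field.
  apply: mulr_ge0; last by rewrite subr_ge0.
  by apply: mulr_ge0 => //; apply: mulr_ge0.
apply: le_trans (even_mono (sqrtr_ge0 _) leV) _.
have := ler_wpM2l t0 (tangent_le V U); have := ler_wpM2l t1 (tangent_le V W).
have : (1 + e) / 2 * (f1 V * (U - V)) + (1 - e) / 2 * (f1 V * (W - V)) = 0.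
  by rewrite {2 4}/V; field.
rewrite !mulrDr; lra.
Qed.

Section second_order.
Context (q : R) (q0 : 0 < q).
(* the factor 1 gives the radicand the form met by [is_derive_quadratic] *)
Let N (t : R) : R := Num.sqrt (q + 1 * t ^+ 2).

Let NE t : N t ^+ 2 = q + t ^+ 2.
Proof. by rewrite sqr_sqrtr mul1r// addr_ge0 ?sqr_ge0// ltW. Qed.

Let N_gt0 t : 0 < N t.
Proof. by rewrite sqrtr_gt0 mul1r ltr_pwDl// sqr_ge0. Qed.

Let dN (t : R) : is_derive t 1 N (t / N t).
Proof.
have qt0 : 0 < q + 1 * t ^+ 2 by rewrite mul1r ltr_pwDl// sqr_ge0.
have /is_derive_eq := @is_derive_comp1 R Num.sqrt
  (fun u => q + 1 * u ^+ 2) t _ _ (is_derive1_sqrt qt0)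
  (is_derive_quadratic q 1 t).
by apply; rewrite -/(N t); field; rewrite gt_eqF.
Qed.

(* [k] is the transverse eigenvalue of the Hessian of [f] of the length, and [y]
   the excess over it of the radial eigenvalue *)
Let k t := f1 (N t) / N t.
Let y t := f2 (N t) - k t.

Let dk (t : R) : is_derive t 1 k (y t * t / N t ^+ 2).
Proof.
have N0 : N t != 0 by rewrite gt_eqF.
have /is_derive_eq := is_deriveM1 (@is_derive_comp1 R f1 N t _ _ (df1 _) (dN t))
  (is_deriveV N0 (dN t)).
by apply; rewrite /y /k /GRing.scale/=; field; rewrite gt_eqF.
Qed.

Let dradial (t : R) : is_derive t 1 (radial q) (k t * t).
Proof.
have -> : radial q = fun t => f (N t).
  by apply/funext => u; rewrite /N mul1r.
have /is_derive_eq := @is_derive_comp1 R f N t _ _ (df _) (dN t).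
by apply; rewrite /k; ring.
Qed.

Let d2radial (t : R) :
  is_derive t 1 (fun t => k t * t) (k t + y t * t ^+ 2 / N t ^+ 2).
Proof.
have /is_derive_eq := @is_deriveM1 R k id t _ _ (dk t) (is_derive_id t 1).
by apply => /=; ring.
Qed.

(** The length is differentiable along a line that avoids the origin, so that
    [square_tangent] applies. *)
Lemma radial_square_tangent_gt0 b s : 0 <= b -> 0 < s ->
  exists c, forall x, 0 <= x ->
    radial q (b + s) + radial q (b - s) + c * (x ^+ 2 - s ^+ 2)
      <= radial q (b + x) + radial q (b - x).
Proof.
move=> b0 s0.
pose d t := k t * t; pose d2 t := k t + y t * t ^+ 2 / N t ^+ 2.
apply: (@square_tangent R (fun x => radial q (b + x) + radial q (b - x))
  (fun x => d (b + 1 * x) + - 1 * d (b + - 1 * x))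
  (fun x => d2 (b + 1 * x) + d2 (b + - 1 * x)) s s0).
- move=> x _; have := is_deriveD1 (is_derive_affine_comp b 1 x dradial)
    (is_derive_affine_comp b (- 1) x dradial).
  under eq_fun do rewrite mul1r mulN1r.
  by move=> /is_derive_eq; apply; rewrite /d; ring.
- move=> x _; apply: is_derive_eq (is_deriveD1 (is_derive_affine_comp b 1 x d2radial)
    (is_deriveZ1 (- 1) (is_derive_affine_comp b (- 1) x d2radial))) _.
  by rewrite /d2; ring.
- by rewrite !mulr0; ring.
move=> x x0; rewrite !mul1r !mulN1r.
have N2 := NE (b + x); have N1 := NE (b - x).
have Nle : N (b - x) <= N (b + x).
  rewrite -ler_sqr ?nnegrE ?(ltW (N_gt0 _))// N1 N2 -subr_ge0.
  have -> : q + (b + x) ^+ 2 - (q + (b - x) ^+ 2) = 4 * (b * x) by ring.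
  by rewrite mulr_ge0 ?mulr_ge0 ?(ltW x0).
have Nf t : f1 (N t) = N t * k t by rewrite mulrC divfK// gt_eqF.
have y0 : 0 <= y (b - x).
  by rewrite subr_ge0 ler_pdivrMr// mulrC derivative_le// (ltW (N_gt0 _)).
have trap : (N (b - x) + N (b + x)) * (k (b + x) - k (b - x)) <=
    (N (b + x) - N (b - x)) * (y (b - x) + y (b + x)).
  have := trapezoid Nle; rewrite !Nf /y.
  move: (k (b + x)) (k (b - x)) (f2 (N (b + x))) (f2 (N (b - x))).
  by move: (N (b + x)) (N (b - x)) => n m k2 k1 g2 g1; lra.
have := radial_key q0 b0 (ltW x0) (N_gt0 (b - x)) (N_gt0 (b + x)) N1 N2 y0
  (derivative_gap_mono (N_gt0 _) Nle) trap.
rewrite /d /d2.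
move: (k (b + x)) (k (b - x)) => k2 k1.
move: (y (b + x) * _ / _) (y (b - x) * _ / _) => v2 v1; lra.
Qed.

End second_order.

(** The sum of the values at two points symmetric about [b] is convex in the square
    of their distance to [b]; the claim is the tangent at distance [s], with the
    distance measured in units of [s]. On a line through the origin [radial] is [f]
    itself, and the bound is a direct consequence of [trapezoid]. *)
Lemma radial_square_tangent q b s : 0 <= q ->
  exists c, forall z, radial q (b + s) + radial q (b - s) + c * (z ^+ 2 - 1)
    <= radial q (b + z * s) + radial q (b - z * s).
Proof.
move=> q0.
wlog s0 : s / 0 <= s.
  move=> wlg; have [/wlg//|/ltW sle0] := leP 0 s.
  have [|c cP] := wlg (- s); first by rewrite oppr_ge0.
  exists c => z; move: (cP z); rewrite mulrN !opprK.
  by rewrite addrC [leRHS]addrC; lra.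
wlog b0 : b / 0 <= b.
  move=> wlg; have [/wlg//|/ltW ble0] := leP 0 b.
  have [|c cP] := wlg (- b); first by rewrite oppr_ge0.
  have flip u : radial q (- b + u) = radial q (b - u).
    by rewrite -radialN opprD opprK.
  by exists c => z; move: (cP z); rewrite !flip !opprK; lra.
move: s0; rewrite le_eqVlt => /predU1P[<-|s0].
  by exists 0 => z; rewrite !mulr0 mul0r addr0.
suff [c cP] : exists c, forall x, 0 <= x ->
    radial q (b + s) + radial q (b - s) + c * (x ^+ 2 - s ^+ 2)
      <= radial q (b + x) + radial q (b - x).
  exists (c * s ^+ 2) => z; have [z0|/ltW z0] := leP 0 z.
    have := cP (z * s) (mulr_ge0 z0 (ltW s0)).
    by rewrite exprMn; lra.
  have := cP (- z * s); rewrite mulr_ge0 ?oppr_ge0 ?(ltW s0)// => /(_ isT).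
  by rewrite mulNr opprK sqrrN exprMn; lra.
move: q0; rewrite le_eqVlt => /predU1P[<-|q0].
  have rE x : radial 0 x = f x.
    rewrite /radial add0r sqrtr_sqr; have [//|x0] := ger0P x.
    by rewrite f_even.
  apply: (@square_tangent R (fun x => radial 0 (b + x) + radial 0 (b - x))
    (fun x => f1 (b + 1 * x) + - 1 * f1 (b + - 1 * x))
    (fun x => f2 (b + 1 * x) + f2 (b + - 1 * x)) s s0).
  - move=> x _; have := is_deriveD1 (is_derive_affine_comp b 1 x df)
      (is_derive_affine_comp b (- 1) x df).
    under eq_fun do rewrite mul1r mulN1r -!rE.
    by move=> /is_derive_eq; apply; rewrite mul1r.
  - move=> x _; apply: is_derive_eq (is_deriveD1 (is_derive_affine_comp b 1 x df1)
      (is_deriveZ1 (- 1) (is_derive_affine_comp b (- 1) x df1))) _.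
    by ring.
  - by rewrite !mulr0; ring.
  move=> x x0; have bx : b + - 1 * x <= b + 1 * x by lra.
  have := trapezoid bx.
  have -> : b + 1 * x - (b + - 1 * x) = 2 * x by ring.
  by lra.
exact: radial_square_tangent_gt0.
Qed.

End smooth_even_convex.

(** * The standard normal law *)

Section normal_density_integral.
Context {R : realType} (m s : R).
Local Open Scope ereal_scope.
Notation lambda := (@lebesgue_measure R).

Let pdf_ge0 x : 0 <= (normal_pdf m s x)%:E.
Proof. by rewrite lee_fin normal_pdf_ge0. Qed.

Let measurable_pdf : measurable_fun setT (fun x => (normal_pdf m s x)%:E).
Proof. by apply/measurable_EFinP; exact: measurable_normal_pdf. Qed.

Import HBNNSimple.

Let integral_normal_nnsfun (g : {nnsfun measurableTypeR R >-> R}) :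
  \int[normal_prob m s]_x (g x)%:E =
  \int[lambda]_x ((g x)%:E * (normal_pdf m s x)%:E).
Proof.
have mg r : measurable (g @^-1` [set r]) by exact: measurable_funPTI.
have mstep r : measurable_fun setT (fun x => (r * \1_(g @^-1` [set r]) x)%:E).
  by apply/measurable_EFinP; apply: measurable_funM.
under [LHS]eq_integral do rewrite fimfunE -fsumEFin//.
rewrite [LHS]ge0_integral_fsum//; last first.
  by move=> r x _; rewrite EFinM nnfun_muleindic_ge0.
under [RHS]eq_integral.
  move=> x _; rewrite fimfunE -fsumEFin// muleC ge0_mule_fsumr; last first.
    by move=> r; rewrite EFinM nnfun_muleindic_ge0.
  over.
rewrite [RHS]ge0_integral_fsum//; last 2 first.
- by move=> r; apply: emeasurable_funM => //; exact: mstep.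
- by move=> r x _; rewrite EFinM mule_ge0// nnfun_muleindic_ge0.
apply: eq_fsbigr => r _.
rewrite integralZl_indic_nnsfun// integral_indic// setIT /= /normal_prob.
have [r0|r0] := leP 0%R r; last first.
  rewrite preimage_nnfun0// integral_set0 mule0 integral0_eq// => x _.
  by rewrite indic0 mulr0 mule0.
rewrite -ge0_integralZl//; last exact: measurable_funTS.
rewrite integral_mkcond; apply: eq_integral => x _.
rewrite patchE indicE; case: ifPn => _; first by rewrite mulr1 muleC.
by rewrite mulr0 mule0.
Qed.

(** The density formula, first on simple functions and then by monotone
    convergence. *)
Lemma ge0_integral_normal_prob (f : measurableTypeR R -> \bar R) :
  measurable_fun setT f -> (forall x, 0 <= f x) ->
  \int[normal_prob m s]_x f x = \int[lambda]_x (f x * (normal_pdf m s x)%:E).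
Proof.
move=> mf f0; pose g := nnsfun_approx measurableT mf.
have gf x : f x = limn (fun n => (g n x)%:E).
  by apply/esym/cvg_lim => //; exact: cvg_nnsfun_approx.
have mg n : measurable_fun setT (fun x => (g n x)%:E).
  exact/measurable_EFinP.
have g0 n x : 0 <= (g n x)%:E by rewrite lee_fin.
have ndg x : {homo (fun n => (g n x)%:E) : n k / (n <= k)%N >-> n <= k}.
  by move=> n k nk; rewrite lee_fin; exact/lefP/nd_nnsfun_approx.
transitivity (limn (fun n => \int[normal_prob m s]_x (g n x)%:E)).
  rewrite -monotone_convergence//.
  by apply: eq_integral => x _; rewrite gf.
transitivity (limn (fun n => \int[lambda]_x ((g n x)%:E * (normal_pdf m s x)%:E))).
  by apply: congr_lim; apply/funext => n; exact: integral_normal_nnsfun.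
rewrite -monotone_convergence//; last 3 first.
- by move=> n; exact: emeasurable_funM.
- by move=> n x _; rewrite mule_ge0.
- by move=> x _ n k nk; rewrite lee_wpmul2r//; exact: ndg.
apply: eq_integral => x _; rewrite gf muleC -limeMl//; last first.
  by apply: ereal_nondecreasing_is_cvgn; exact: ndg.
by apply: congr_lim; apply/funext => n; rewrite muleC.
Qed.

End normal_density_integral.

Section lebesgue_invariance.
Context {R : realType}.
Local Open Scope ereal_scope.
Notation lambda := (@lebesgue_measure R).

Let shift (a : R) : measurableTypeR R -> measurableTypeR R := fun x => (x + a)%R.

Let measurable_shift a : measurable_fun setT (shift a).
Proof. exact: measurable_funD. Qed.

HB.instance Definition _ a :=
  isMeasurableFun.Build _ _ _ _ (shift a) (measurable_shift a).

Lemma ge0_integral_shift (a : R) (f : measurableTypeR R -> \bar R) :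
  measurable_fun setT f -> (forall x, 0 <= f x) ->
  \int[lambda]_x f (x + a)%R = \int[lambda]_x f x.
Proof.
move=> mf f0.
transitivity (\int[pushforward lambda (shift a)]_x f x).
  by rewrite ge0_integral_pushforward//; exact: measurable_shift.
apply: eq_measure_integral => A mA _; apply/esym.
apply: lebesgue_measure_unique => //= _ [[x y]] _ <-.
have -> : pushforward lambda (shift a) `]x, y]%classic =
    lambda `](x - a)%R, (y - a)%R]%classic.
  congr (lambda _); apply/seteqP; split => z /=; rewrite !in_itv/=.
    by rewrite ltrBlDr lerBrDr.
  by rewrite ltrBlDr lerBrDr.
rewrite /= !lebesgue_measure_itv/= !lte_fin ltrD2r.
by case: ifP => // _; rewrite -!EFinD; congr EFin; ring.
Qed.

Lemma ge0_integral_opp (f : measurableTypeR R -> \bar R) :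
  measurable_fun setT f -> (forall x, 0 <= f x) ->
  \int[lambda]_x f (- x)%R = \int[lambda]_x f x.
Proof.
move=> mf f0.
transitivity (\int[pushforward lambda (-%R : _ -> measurableTypeR R)]_x f x).
  by rewrite ge0_integral_pushforward.
by apply: eq_measure_integral => A mA _; exact: lebesgue_measureN.
Qed.

End lebesgue_invariance.

Section standard_normal.
Context {R : realType}.
Local Open Scope ereal_scope.
Notation lambda := (@lebesgue_measure R).
Notation gauss := (@normal_prob R 0 1).
Notation mR := (measurableTypeR R).

Lemma standard_normal_pdfE (x : R) :
  normal_pdf 0 1 x = (normal_peak 1 * expR (- x ^+ 2 / 2))%R.
Proof.
by rewrite normal_pdfE ?oner_neq0// /normal_fun subr0 expr1n.
Qed.

Lemma ge0_integral_normal_opp (f : measurableTypeR R -> \bar R) :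
  measurable_fun setT f -> (forall x, 0 <= f x) ->
  \int[gauss]_x f (- x)%R = \int[gauss]_x f x.
Proof.
move=> mf f0; rewrite !ge0_integral_normal_prob//; last first.
  exact: measurableT_comp.
rewrite -[RHS]ge0_integral_opp.
- by apply: eq_integral => x _; rewrite !standard_normal_pdfE sqrrN.
- apply: emeasurable_funM => //.
  by apply/measurable_EFinP; exact: measurable_normal_pdf.
- by move=> x; rewrite mule_ge0// lee_fin normal_pdf_ge0.
Qed.

Section rotation.
Variable a b : R.
Hypotheses (ab1 : (a ^+ 2 + b ^+ 2 = 1)%R) (aN1 : (1 + a != 0)%R).
Variable H : mR * mR -> \bar R.
Hypotheses (mH : measurable_fun setT H) (H0 : forall p, 0 <= H p).

(** The joint density depends on the distance to the origin only, and Lebesgue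
    measure is invariant under shears, by Fubini's theorem and translation
    invariance on the line. *)
Lemma normal_rotation :
  \int[gauss]_x \int[gauss]_y H (a * x - b * y, b * x + a * y)%R =
  \int[gauss]_x \int[gauss]_y H (x, y).
Proof.
pose G (p : mR * mR) := H p *
  (normal_peak 1 ^+ 2 * expR (- (p.1 ^+ 2 + p.2 ^+ 2) / 2))%:E.
have mG : measurable_fun setT G.
  apply: emeasurable_funM => //; apply/measurable_EFinP.
  apply: measurable_funM => //; apply: measurableT_comp => //.
  apply: measurable_funM => //; apply: measurableT_comp => //.
  by apply: measurable_funD; apply: measurable_funX.
have G0 p : 0 <= G p.
  by rewrite mule_ge0// lee_fin mulr_ge0 ?expR_ge0// exprn_ge0// normal_peak_ge0.
have toG (F : mR * mR -> \bar R) : measurable_fun setT F -> (forall p, 0 <= F p) ->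
    \int[gauss]_x \int[gauss]_y F (x, y) = \int[lambda]_x \int[lambda]_y
    (F (x, y) * (normal_peak 1 ^+ 2 * expR (- (x ^+ 2 + y ^+ 2) / 2))%:E).
  move=> mF F0.
  have mFx x : measurable_fun setT (fun y => F (x, y)) by exact: measurableT_comp.
  rewrite ge0_integral_normal_prob//; first last.
  - by move=> x; exact: integral_ge0.
  - exact: (measurable_fun_fubini_tonelli_F (m2 := gauss)).
  apply: eq_integral => x _; rewrite ge0_integral_normal_prob//.
  rewrite muleC -ge0_integralZl//; first last.
  - by rewrite lee_fin normal_pdf_ge0.
  - by move=> y _; rewrite mule_ge0// lee_fin normal_pdf_ge0.
  - apply: emeasurable_funM => //.
    by apply/measurable_EFinP; exact: measurable_normal_pdf.
  apply: eq_integral => y _; rewrite muleCA -EFinM; congr (_ * _%:E).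
  rewrite !standard_normal_pdfE mulrACA -expRD -expr2; congr (_ * expR _)%R.
  by field.
pose t := (b / (1 + a))%R.
have shearx (c : R) (F : mR * mR -> \bar R) : measurable_fun setT F ->
    (forall p, 0 <= F p) ->
    \int[lambda]_x \int[lambda]_y F (x - c * y, y)%R =
    \int[lambda]_x \int[lambda]_y F (x, y).
  move=> mF F0.
  have mS : measurable_fun setT (fun p : mR * mR => F (p.1 - c * p.2, p.2)%R).
    apply: (measurableT_comp mF); apply: measurable_fun_pair => //=.
    by apply: measurable_funB => //; apply: measurable_funM.
  have := fubini_tonelli (m1 := lambda) (m2 := lambda) _ mS (fun p => F0 _).
  move=> /= ->; rewrite (fubini_tonelli F mF F0); apply: eq_integral => y _.
  rewrite (@ge0_integral_shift R (- (c * y)) (fun x => F (x, y)))//.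
  exact: measurable_fun_pair1.
have sheary (c : R) (F : mR * mR -> \bar R) : measurable_fun setT F ->
    (forall p, 0 <= F p) ->
    \int[lambda]_x \int[lambda]_y F (x, c * x + y)%R =
    \int[lambda]_x \int[lambda]_y F (x, y).
  move=> mF F0; apply: eq_integral => x _.
  under eq_integral do rewrite addrC.
  rewrite (@ge0_integral_shift R (c * x) (fun y => F (x, y)))//.
  exact: measurable_fun_pair2.
(* a rotation is the product of a horizontal, a vertical and a second horizontal
   shear; [t] is the tangent of half its angle *)
pose K1 (p : mR * mR) := G (p.1 - t * p.2, p.2)%R.
pose K2 (p : mR * mR) := K1 (p.1, b * p.1 + p.2)%R.
have mK1 : measurable_fun setT K1.
  apply: (measurableT_comp mG); apply: measurable_fun_pair => //=.
  by apply: measurable_funB => //; apply: measurable_funM.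
have mK2 : measurable_fun setT K2.
  apply: (measurableT_comp mK1); apply: measurable_fun_pair => //=.
  by apply: measurable_funD => //; apply: measurable_funM.
rewrite (toG H)//.
rewrite (toG (fun p => H (a * p.1 - b * p.2, b * p.1 + a * p.2)%R))/=; last 2 first.
- apply: (measurableT_comp mH); apply: measurable_fun_pair => /=.
    by apply: measurable_funB; apply: measurable_funM.
  by apply: measurable_funD; apply: measurable_funM.
- by [].
transitivity (\int[lambda]_x \int[lambda]_y K2 (x - t * y, y)%R).
  apply: eq_integral => x _; apply: eq_integral => y _.
  have tE : (b * t = 1 - a)%R.
    by rewrite /t mulrA -expr2 (_ : b ^+ 2 = 1 - a ^+ 2)%R; [field|rewrite -ab1; ring].
  have tE' : (t * (1 + a) = b)%R by rewrite /t divfK.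
  have Ey : (b * (x - t * y) + y = b * x + a * y)%R.
    by rewrite mulrBr mulrA tE; ring.
  have Ex : (x - t * y - t * (b * x + a * y) = a * x - b * y)%R.
    transitivity ((1 - b * t) * x - (t * (1 + a)) * y)%R; first by ring.
    by rewrite tE tE'; ring.
  rewrite /K2 /K1 /G /= Ey Ex; congr (_ * (_ * expR _)%:E); congr (- _ / _)%R.
  by transitivity ((a ^+ 2 + b ^+ 2) * (x ^+ 2 + y ^+ 2))%R; [rewrite ab1 mul1r|ring].
transitivity (\int[lambda]_x \int[lambda]_y K2 (x, y)).
  exact: (shearx t K2 mK2 (fun p => G0 _)).
transitivity (\int[lambda]_x \int[lambda]_y K1 (x, y)).
  exact: (sheary b K1 mK1 (fun p => G0 _)).
exact: (shearx t G mG G0).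
Qed.

End rotation.
End standard_normal.

Section standard_normal_variance.
Context {R : realType}.
Local Open Scope ereal_scope.
Notation lambda := (@lebesgue_measure R).
Notation gauss := (@normal_prob R 0 1).
Notation mR := (measurableTypeR R).

Let V := \int[gauss]_z ((z : mR) ^+ 2)%:E.

(** The inequality [1 + u <= expR u] applied to the quotient of the densities with
    standard deviations [s] and one. *)
Let density_ge (s x : R) : (0 < s)%R ->
  (normal_pdf 0 1 x + (1 - s ^- 2) / 2 * (x ^+ 2 * normal_pdf 0 1 x)
    <= s * normal_pdf 0 s x)%R.
Proof.
move=> s0; rewrite standard_normal_pdfE normal_pdfE ?gt_eqF// /normal_fun subr0.
have -> : normal_peak s = (normal_peak 1 / s)%R.
  rewrite /normal_peak expr1n mul1r -mulrnAr sqrtrM ?sqr_ge0//.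
  by rewrite sqrtr_sqr ger0_norm ?(ltW s0)// invfM mulrC.
set c := normal_peak 1; have c0 : (0 <= c)%R by exact: normal_peak_ge0.
have -> : (s * (c / s * expR (- x ^+ 2 / (s ^+ 2 *+ 2))) =
    c * expR (- x ^+ 2 / (s ^+ 2 *+ 2)))%R by field; rewrite gt_eqF.
have -> : (c * expR (- x ^+ 2 / 2) +
    (1 - s ^- 2) / 2 * (x ^+ 2 * (c * expR (- x ^+ 2 / 2))) =
    c * (expR (- x ^+ 2 / 2) * (1 + x ^+ 2 * (1 - s ^- 2) / 2)))%R by ring.
rewrite ler_wpM2l//.
have -> : (- x ^+ 2 / (s ^+ 2 *+ 2) =
    - x ^+ 2 / 2 + x ^+ 2 * (1 - s ^- 2) / 2)%R.
  by rewrite -mulr_natr; field; rewrite gt_eqF.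
by rewrite expRD ler_wpM2l ?expR_ge0// expR_ge1Dx.
Qed.

Let VE : V = \int[lambda]_x (x ^+ 2 * normal_pdf 0 1 x)%:E.
Proof.
rewrite /V ge0_integral_normal_prob//.
by apply/measurable_EFinP; apply: measurable_funX.
by move=> x; rewrite lee_fin sqr_ge0.
Qed.

Let measurable_pdf (s : R) :
  measurable_fun setT (fun x : mR => (normal_pdf 0 s x)%:E).
Proof. by apply/measurable_EFinP; exact: measurable_normal_pdf. Qed.

Let measurable_second :
  measurable_fun setT (fun x : mR => (x ^+ 2 * normal_pdf 0 1 x)%:E).
Proof.
apply/measurable_EFinP/measurable_funM; first exact: measurable_funX.
exact: measurable_normal_pdf.
Qed.

Let pdf_ge0 (s x : R) : 0 <= (normal_pdf 0 s x)%:E.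
Proof. by rewrite lee_fin normal_pdf_ge0. Qed.

Let second_ge0 (x : R) : 0 <= (x ^+ 2 * normal_pdf 0 1 x)%:E.
Proof. by rewrite lee_fin mulr_ge0 ?sqr_ge0// normal_pdf_ge0. Qed.

Let V_ge0 : 0 <= V.
Proof. by apply: integral_ge0 => x _; rewrite lee_fin sqr_ge0. Qed.

Let V_le (s : R) : (1 < s)%R -> 1 + ((1 - s ^- 2) / 2)%:E * V <= s%:E.
Proof.
move=> s1; have s0 : (0 < s)%R by exact: lt_trans s1.
have k0 : (0 <= (1 - s ^- 2) / 2)%R.
  by rewrite divr_ge0// subr_ge0 invf_le1 ?exprn_gt0// exprn_ege1// ltW.
rewrite -(integral_normal_pdf 0 1) VE -ge0_integralZl//.
rewrite -ge0_integralD//; last 2 first.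
- by move=> x _; rewrite mule_ge0.
- by apply: measurable_funeM.
rewrite -[leRHS]mule1 -(integral_normal_pdf 0 s) -ge0_integralZl//; last first.
  by rewrite lee_fin ltW.
apply: ge0_le_integral => //.
- by move=> x _; rewrite adde_ge0// mule_ge0.
- by apply: emeasurable_funD => //; exact: measurable_funeM.
- exact: measurable_funeM.
by move=> x _; rewrite -!EFinM -EFinD lee_fin density_ge.
Qed.

Let V_ge (s : R) : (0 < s < 1)%R -> 1 <= s%:E + ((s ^- 2 - 1) / 2)%:E * V.
Proof.
move=> /andP[s0 s1].
have k0 : (0 <= (s ^- 2 - 1) / 2)%R.
  by rewrite divr_ge0// subr_ge0 invf_ge1 ?exprn_gt0// exprn_ile1// ltW.
rewrite -(integral_normal_pdf 0 1) VE -ge0_integralZl//.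
rewrite -[s%:E]mule1 -(integral_normal_pdf 0 s) -ge0_integralZl//; last first.
  by rewrite lee_fin ltW.
rewrite -ge0_integralD//; last 4 first.
- by move=> x _; rewrite mule_ge0// lee_fin ltW.
- exact: measurable_funeM.
- by move=> x _; rewrite mule_ge0.
- exact: measurable_funeM.
apply: ge0_le_integral => //.
- by apply: emeasurable_funD; exact: measurable_funeM.
by move=> x _; rewrite -!EFinM -EFinD lee_fin; have := density_ge x s0; lra.
Qed.

(** Integrating [density_ge], whose right side has integral [s], and letting [s]
    tend to one from above and from below, bounds the variance from both sides. *)
Lemma standard_normal_variance : \int[gauss]_z ((z : mR) ^+ 2)%:E = 1.
Proof.
have : V < +oo.
  rewrite ltey; apply/negP => /eqP Voo.
  by have := @V_le 2 (ltr1n _ 2); rewrite Voo gt0_muley// lte_fin; lra.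
move: V_ge0 V_le V_ge; rewrite -/V; case: V => // v; rewrite lee_fin => v0 vle vge _.
congr EFin; apply/eqP; rewrite eq_le; apply/andP; split;
  apply/ler_addgt0Pr => e e0; pose d := (e / (3 + 3 * e))%R.
- have d0 : (0 < d)%R by rewrite divr_gt0//; lra.
  have de : (3 * d <= e)%R.
    by rewrite /d mulrA ler_pdivrMr; [nra|lra].
  have d1 : (d <= 1)%R by rewrite ler_pdivrMr ?mul1r; lra.
  have := vle (1 + d)%R; rewrite ltrDl => /(_ d0).
  rewrite -EFinM -EFinD lee_fin.
  have -> : ((1 - (1 + d) ^- 2) / 2 * v = d * ((2 + d) * v) / (2 * (1 + d) ^+ 2))%R.
    by field; rewrite gt_eqF//; lra.
  have D0 : (0 < 2 * (1 + d) ^+ 2)%R by rewrite mulr_gt0// exprn_gt0//; lra.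
  rewrite lerD2l ler_pdivrMr// ler_pM2l// => h; nra.
- have d0 : (0 < d)%R by rewrite divr_gt0//; lra.
  have de : (3 * d <= e)%R.
    by rewrite /d mulrA ler_pdivrMr; [nra|lra].
  have d1 : (3 * d < 1)%R by rewrite mulrA ltr_pdivrMr ?mul1r; lra.
  have := vge (1 - d)%R; rewrite subr_gt0 gtrBl d0 andbT => /(_ _).
  have d1' : (d < 1)%R by lra.
  move=> /(_ d1'); rewrite -EFinM -EFinD lee_fin.
  have -> : (((1 - d) ^- 2 - 1) / 2 * v = d * ((2 - d) * v) / (2 * (1 - d) ^+ 2))%R.
    by field; rewrite gt_eqF//; lra.
  have D0 : (0 < 2 * (1 - d) ^+ 2)%R by rewrite mulr_gt0// exprn_gt0//; lra.
  rewrite -[leLHS](subrK d) lerD2l ler_pdivlMr// ler_pM2l// => h; nra.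
Qed.

End standard_normal_variance.

Lemma integral_probability_cst d (T : measurableType d) (R : realType)
    (P : probability T R) (c : \bar R) : (\int[P]_t cst c t = c)%E.
Proof. by rewrite integral_cst//= probability_setT mule1. Qed.

(** * Averages over Gaussian displacements of a vector *)

Section inner_product.
Context {R : realType} {n : nat}.
Implicit Types (u v w : 'cV[R]_n) (a : R).

Definition dot u v : R := (u^T *m v) 0 0.

Lemma dotE u v : dot u v = \sum_i u i 0 * v i 0.
Proof. by rewrite /dot mxE; apply: eq_bigr => i _; rewrite mxE. Qed.

Lemma dotC u v : dot u v = dot v u.
Proof. by rewrite !dotE; apply: eq_bigr => i _; rewrite mulrC. Qed.

Lemma dotDr u v w : dot u (v + w) = dot u v + dot u w.
Proof. by rewrite /dot mulmxDr mxE. Qed.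

Lemma dotZr u a v : dot u (a *: v) = a * dot u v.
Proof. by rewrite /dot -scalemxAr mxE. Qed.

Lemma dotDl u v w : dot (v + w) u = dot v u + dot w u.
Proof. by rewrite !(dotC _ u) dotDr. Qed.

Lemma dotZl u a v : dot (a *: v) u = a * dot v u.
Proof. by rewrite !(dotC _ u) dotZr. Qed.

Lemma dot_ge0 v : 0 <= dot v v.
Proof. by rewrite dotE sumr_ge0// => i _; rewrite -expr2 sqr_ge0. Qed.

Lemma dot_eq0 v : (dot v v == 0) = (v == 0).
Proof.
apply/eqP/eqP => [|->]; last by rewrite dotE big1// => i _; rewrite mxE mul0r.
rewrite dotE => /eqP; rewrite psumr_eq0; last by move=> i _; rewrite -expr2 sqr_ge0.
move=> /allP v0; apply/colP => i; rewrite mxE; apply/eqP.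
by rewrite -sqrf_eq0 expr2 (implyP (v0 i _))// mem_index_enum.
Qed.

Lemma outer_mulE u v : v *m v^T *m u = dot v u *: v.
Proof.
rewrite -mulmxA; apply/colP => i.
by rewrite !mxE big_ord_recl big_ord0 addr0 /dot mulrC.
Qed.

End inner_product.

Section gaussian_average.
Context {R : realType} {n : nat}.
Local Open Scope ereal_scope.
Notation V := 'cV[R]_n.
Notation mR := (measurableTypeR R).
Notation gauss := (@normal_prob R 0 1).
Implicit Types (F G : V -> \bar R) (x y v : V) (xs ys : seq V).

Definition coord_measurable d (T : measurableType d) (c : T -> V) :=
  forall i, measurable_fun setT (fun t => (c t i 0)%R).

(** Measurability for the product of the Borel structures of the coordinates,
    expressed by composition with every measurable family of vectors. In this form
    it applies at once to families indexed by pairs and to smaller sigma-algebras on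
    the index space. *)
Definition borel_fun F := forall d (T : measurableType d) (c : T -> V),
  coord_measurable c -> measurable_fun setT (fun t => F (c t)).

Definition gauss_avg x F v := \int[gauss]_z F (v + (z : R) *: x)%R.

Definition gauss_avgs xs F := foldr gauss_avg F xs.

Lemma coord_measurable_cst d (T : measurableType d) v :
  coord_measurable (fun _ : T => v).
Proof. by move=> i; exact: measurable_cst. Qed.

Lemma coord_measurableD d (T : measurableType d) (c e : T -> V) :
  coord_measurable c -> coord_measurable e ->
  coord_measurable (fun t => c t + e t)%R.
Proof.
move=> mc me i; under eq_fun do rewrite mxE.
exact: measurable_funD.
Qed.

Lemma coord_measurableZ d (T : measurableType d) (k : T -> R) x :
  measurable_fun setT k -> coord_measurable (fun t => k t *: x)%R.
Proof.
move=> mk i; under eq_fun do rewrite mxE.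
exact: measurable_funM.
Qed.

Lemma coord_measurable_comp d (T : measurableType d) d' (T' : measurableType d')
    (c : T -> V) (g : T' -> T) :
  coord_measurable c -> measurable_fun setT g ->
  coord_measurable (fun t => c (g t)).
Proof. by move=> mc mg i; exact: (measurableT_comp (mc i) mg). Qed.

Lemma borel_line F v x : borel_fun F ->
  measurable_fun setT (fun z : mR => F (v + (z : R) *: x)%R).
Proof.
move=> bF; apply: bF; apply: coord_measurableD; first exact: coord_measurable_cst.
exact: coord_measurableZ.
Qed.

Lemma borel_plane F v x y : borel_fun F ->
  measurable_fun setT
    (fun p : mR * mR => F (v + (p.1 : R) *: x + (p.2 : R) *: y)%R).
Proof.
move=> bF; apply: bF; apply: coord_measurableD; last exact: coord_measurableZ.
apply: coord_measurableD; first exact: coord_measurable_cst.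
exact: coord_measurableZ.
Qed.

Lemma gauss_avg_ge0 x F v : (forall w, 0 <= F w) -> 0 <= gauss_avg x F v.
Proof. by move=> F0; exact: integral_ge0. Qed.

Lemma gauss_avg_borel x F : borel_fun F -> (forall w, 0 <= F w) ->
  borel_fun (gauss_avg x F).
Proof.
move=> bF F0 d T c mc.
apply: (measurable_fun_fubini_tonelli_F (m2 := gauss)
  (fun p : T * mR => F (c p.1 + (p.2 : R) *: x)%R)) => //.
apply: bF; apply: coord_measurableD; last exact: coord_measurableZ.
exact: coord_measurable_comp.
Qed.

Lemma gauss_avgs_ge0 xs F v : (forall w, 0 <= F w) -> 0 <= gauss_avgs xs F v.
Proof.
by move=> F0; elim: xs v => //= x xs IH v; exact: gauss_avg_ge0.
Qed.

Lemma gauss_avgs_borel xs F : borel_fun F -> (forall w, 0 <= F w) ->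
  borel_fun (gauss_avgs xs F).
Proof.
move=> bF F0; elim: xs => //= x xs IH.
by apply: gauss_avg_borel => // w; exact: gauss_avgs_ge0.
Qed.

Lemma gauss_avgC x y F v : borel_fun F -> (forall w, 0 <= F w) ->
  gauss_avg x (gauss_avg y F) v = gauss_avg y (gauss_avg x F) v.
Proof.
move=> bF F0; rewrite /gauss_avg.
have := fubini_tonelli (m1 := gauss) (m2 := gauss) _ (borel_plane v x y bF)
  (fun=> F0 _).
move=> /= ->; apply: eq_integral => z _; apply: eq_integral => t _.
by rewrite addrAC.
Qed.

Lemma gauss_avg_opp x F v : borel_fun F -> (forall w, 0 <= F w) ->
  gauss_avg (- x) F v = gauss_avg x F v.
Proof.
move=> bF F0; rewrite /gauss_avg -[RHS]ge0_integral_normal_opp//.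
  by apply: eq_integral => z _; rewrite scalerN scaleNr.
exact: borel_line.
Qed.

(** [a = -1] is excluded because the half-angle of such a rotation has no
    tangent. *)
Lemma gauss_avg_rotate (a b : R) x y F v :
  (a ^+ 2 + b ^+ 2 = 1)%R -> (1 + a != 0)%R ->
  borel_fun F -> (forall w, 0 <= F w) ->
  gauss_avg (a *: x + b *: y) (gauss_avg (- b *: x + a *: y) F) v =
  gauss_avg x (gauss_avg y F) v.
Proof.
move=> ab1 aN1 bF F0; rewrite /gauss_avg.
have := normal_rotation ab1 aN1 (borel_plane v x y bF) (fun=> F0 _).
move=> /= <-; apply: eq_integral => z _; apply: eq_integral => t _.
congr F; rewrite -!addrA; congr (_ + _)%R.
rewrite !scalerDr !scalerA !scalerDl addrACA !mulrN.
by rewrite ![(t * _)%R]mulrC ![(z * _)%R]mulrC.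
Qed.

End gaussian_average.

(** * The length of a Gaussian vector *)

Section gaussian_alignment.
Context {R : realType} {n : nat}.
Local Open Scope ereal_scope.
Notation V := 'cV[R]_n.
Notation mR := (measurableTypeR R).
Notation gauss := (@normal_prob R 0 1).
Implicit Types (F G : V -> \bar R) (u v w x y : V) (xs ys : seq V).

Definition gram xs : 'M[R]_n := (\sum_(x <- xs) x *m x^T)%R.

Lemma gram_cons x xs : gram (x :: xs) = (x *m x^T + gram xs)%R.
Proof. by rewrite /gram big_cons. Qed.

Lemma mxtrace_gram xs : (\tr (gram xs) = \sum_(x <- xs) dot x x)%R.
Proof.
rewrite /gram raddf_sum/=; apply: eq_bigr => x _.
by rewrite mxtrace_mulC trace_mx11.
Qed.

Lemma gram_mul_orth u xs : (forall x, x \in xs -> dot u x = 0%R) ->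
  (gram xs *m u = 0)%R.
Proof.
move=> xs0; rewrite /gram mulmx_suml big_seq big1// => x xxs.
by rewrite outer_mulE dotC xs0// scale0r.
Qed.

Lemma trmx_gram xs : ((gram xs)^T = gram xs)%R.
Proof.
rewrite /gram raddf_sum/=; apply: eq_bigr => x _.
by rewrite trmx_mul trmxK.
Qed.

(** A Gaussian combination can be rewritten, one rotation at a time, so that a
    prescribed linear functional vanishes on all its directions but one. The sum of
    the operators [x *m x^T] is not affected. *)
Lemma gauss_avgs_align u xs : xs != [::] -> exists y ys,
  [/\ forall F, borel_fun F -> (forall w, 0 <= F w) ->
        gauss_avgs xs F = gauss_avgs (y :: ys) F,
      gram (y :: ys) = gram xs
    & forall z, z \in ys -> dot u z = 0%R].
Proof.
elim: xs => // x [|x' xs] IH _; first by exists x, [::].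
have [//|y [ys [LE gE ys0]]] := IH.
have [uy0|uy0] := eqVneq (dot u y) 0%R.
  exists x, (y :: ys); split.
  - move=> F bF F0.
    transitivity (gauss_avg x (gauss_avgs (x' :: xs) F)); first by [].
    by rewrite (LE F bF F0).
  - by rewrite gram_cons gE -gram_cons.
  - by move=> z; rewrite inE => /predU1P[->//|]; exact: ys0.
pose rho := Num.sqrt (dot u x ^+ 2 + dot u y ^+ 2)%R.
have rho2 : (rho ^+ 2 = dot u x ^+ 2 + dot u y ^+ 2)%R.
  by rewrite sqr_sqrtr// addr_ge0 ?sqr_ge0.
have rho0 : (rho != 0)%R.
  rewrite -sqrf_eq0 rho2 gt_eqF// ltr_wpDl ?sqr_ge0//.
  by rewrite lt_neqAle eq_sym sqrf_eq0 uy0 sqr_ge0.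
pose a := (dot u x / rho)%R; pose b := (dot u y / rho)%R.
have ab1 : (a ^+ 2 + b ^+ 2 = 1)%R.
  by rewrite !expr_div_n -mulrDl -rho2 divff// sqrf_eq0.
have b0 : (b != 0)%R by rewrite mulf_neq0// invr_eq0.
have aN1 : (1 + a != 0)%R.
  apply: contra b0 => /eqP a1; rewrite -sqrf_eq0; apply/eqP.
  have -> : (b ^+ 2 = 1 - a ^+ 2)%R by rewrite -ab1; ring.
  by transitivity ((1 - a) * (1 + a))%R; [ring|rewrite a1 mulr0].
exists (a *: x + b *: y)%R, ((- b *: x + a *: y)%R :: ys); split.
- move=> F bF F0.
  transitivity (gauss_avg x (gauss_avgs (x' :: xs) F)); first by [].
  rewrite (LE F bF F0); apply/funext => v.
  rewrite [LHS]/= [RHS]/= gauss_avg_rotate//.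
    exact: gauss_avgs_borel.
  by move=> w; exact: gauss_avgs_ge0.
- rewrite [RHS]gram_cons -gE !gram_cons !addrA; congr (_ + _)%R.
  apply/matrixP => i j; rewrite !(mxE, big_ord_recl, big_ord0) !addr0.
  rewrite -[RHS]mul1r -ab1; ring.
- move=> z; rewrite inE => /predU1P[->|]; last exact: ys0.
  by rewrite dotDr !dotZr /a /b; field.
Qed.

Lemma gauss_avgs_zero xs F w : (forall x, x \in xs -> x = 0%R) ->
  (forall v, 0 <= F v) -> gauss_avgs xs F w = F w.
Proof.
move=> xs0 F0; elim: xs xs0 => // x xs IH xs0 /=.
rewrite /gauss_avg (xs0 x) ?mem_head//.
transitivity (\int[gauss]_z cst (F w) z).
  apply: eq_integral => z _; rewrite scaler0 addr0 IH// => y yxs.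
  by apply: xs0; rewrite inE yxs orbT.
exact: integral_probability_cst.
Qed.

Lemma borel_dot (H : mR -> \bar R) : measurable_fun setT H ->
  borel_fun (fun v => H (dot v v)).
Proof.
move=> mH d T c mc; apply: (measurableT_comp mH).
under eq_fun do rewrite dotE.
by apply: measurable_sum => i; exact: measurable_funM.
Qed.

(** Rotating the directions onto an orthonormal basis of the range of their
    Gram operator splits off one squared standard normal variable at a time. *)
Lemma gauss_avgs_chi_square (H : mR -> \bar R) r xs w :
  measurable_fun setT H -> (forall s, 0 <= H s) ->
  (gram xs *m gram xs = gram xs)%R -> (\tr (gram xs) = r%:R)%R ->
  (gram xs *m w = 0)%R ->
  gauss_avgs xs (fun v => H (dot v v)) w =
  \int[chi_square_prob R r]_s H (dot w w + s)%R.
Proof.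
move=> mH H0; elim: r xs w => [|r IH] xs w gg gtr gw.
  rewrite /= integral_dirac//; last by apply: (measurableT_comp mH); exact: measurable_funD.
  rewrite diracT mul1e addr0; apply: gauss_avgs_zero => // x xxs.
  move/eqP: gtr; rewrite mxtrace_gram psumr_eq0; last by move=> y _; exact: dot_ge0.
  by move=> /allP/(_ _ xxs)/=; rewrite dot_eq0 => /eqP.
have g0 : gram xs != 0%R.
  by apply/eqP => g0; move: gtr => /eqP; rewrite g0 mxtrace0 eq_sym pnatr_eq0.
have xs0 : xs != [::].
  by apply: contra g0 => /eqP ->; rewrite /gram big_nil.
have [j gj] : exists j, col j (gram xs) != 0%R.
  apply/existsP; apply: contraR g0; rewrite negb_exists => /forallP h.
  apply/eqP/matrixP => i j; have := h j; rewrite negbK => /eqP/colP/(_ i).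
  by rewrite !mxE.
(* a nonzero vector fixed by the projector; after the alignment with respect to it,
   the first direction has length one and is orthogonal to all the others *)
pose u := col j (gram xs).
have gu : (gram xs *m u = u)%R by rewrite /u colE mulmxA gg.
have [y [ys [LE gE ys0]]] := gauss_avgs_align u xs0.
have {LE} -> := LE _ (borel_dot mH) (fun=> H0 _).
have gys0 := gram_mul_orth ys0.
have uE : (dot y u *: y = u)%R.
  by rewrite -outer_mulE -[RHS]gu -gE gram_cons mulmxDl gys0 addr0.
have yu0 : dot y u != 0%R.
  by apply: contra gj => /eqP yu0; rewrite -/u -uE yu0 scale0r.
have yE : (y = (dot y u)^-1 *: u)%R by rewrite -[X in (_ *: X)%R]uE scalerA mulVf// scale1r.
have gy : (gram ys *m y = 0)%R by rewrite yE -scalemxAr gys0 scaler0.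
have y1 : dot y y = 1%R.
  have : (gram xs *m y = y)%R by rewrite yE -scalemxAr gu.
  rewrite -gE gram_cons mulmxDl gy addr0 outer_mulE => /eqP.
  rewrite -subr_eq0 -[X in (_ - X)%R]scale1r -scalerBl scaler_eq0 subr_eq0.
  move=> /orP[/eqP//|/eqP y0]; move: yu0; rewrite y0.
  by rewrite dotE big1 ?eqxx// => i _; rewrite mxE mul0r.
have gysE : (gram ys = gram xs - y *m y^T)%R by rewrite -gE gram_cons addrC addKr.
have ytg : (y^T *m gram ys = 0)%R.
  by apply: trmx_inj; rewrite trmx_mul trmxK trmx_gram gy trmx0.
have ggys : (gram ys *m gram ys = gram ys)%R.
  have : (gram xs *m gram ys = gram ys)%R.
    rewrite gysE mulmxBr gg mulmxA; congr (_ - _ *m _)%R.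
    by rewrite yE -scalemxAr gu.
  by rewrite -[in X in X -> _]gE gram_cons mulmxDl -mulmxA ytg mulmx0 add0r.
have trys : (\tr (gram ys) = r%:R)%R.
  rewrite gysE linearB/= gtr mxtrace_mulC trace_mx11 -[(y^T *m y) 0%R 0%R]/(dot y y) y1.
  by rewrite -natr1 addrK.
have yw : dot y w = 0%R.
  have gyx : (gram xs *m y = y)%R by rewrite yE -scalemxAr gu.
  by rewrite -gyx /dot trmx_mul trmx_gram -mulmxA gw mulmx0 mxE.
have gysw : (gram ys *m w = 0)%R.
  by rewrite gysE mulmxBl gw outer_mulE yw scale0r subrr.
rewrite [LHS]/= /gauss_avg.
under eq_integral => z _.
  rewrite (IH ys) ?mulmxDr ?gysw ?add0r -?scalemxAr ?gy ?scaler0//.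
  rewrite dotDl !dotDr !dotZl !dotZr (dotC w) yw y1 !mulr0 add0r addr0 mulr1.
  over.
rewrite /= ge0_integral_distribution//; last first.
  by apply: (measurableT_comp mH); exact: measurable_funD.
have mHw : measurable_fun setT
    ((fun s : mR => H (dot w w + s)%R) \o @add_square R).
  apply: (measurableT_comp mH); apply: measurable_funD => //.
  exact: measurable_add_square.
rewrite (fubini_tonelli2 _ mHw (fun p => H0 _)).
apply: eq_integral => z _; apply: eq_integral => s _ /=.
by congr H; rewrite /add_square /=; ring.
Qed.

End gaussian_alignment.

(** * Functions that increase in mean under the replacements *)

Section two_point_class.
Context {R : realType} {n : nat}.
Local Open Scope ereal_scope.
Notation V := 'cV[R]_n.
Notation mR := (measurableTypeR R).
Notation gauss := (@normal_prob R 0 1).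
Implicit Types (F G : V -> \bar R) (u v w x y : V) (xs ys : seq V).

(** The functions whose mean increases when a bounded centred variable is first
    replaced by a random sign and then by a standard normal variable: the chord
    inequality, averaged over such a variable, gives the first step. *)
Record two_point F : Prop := TwoPoint {
  two_point_borel : borel_fun F ;
  two_point_ge0 : forall v, 0 <= F v ;
  two_point_chord : forall v x (e : R), (`|e| <= 1)%R ->
    F (v + e *: x)%R <=
      ((1 + e) / 2)%:E * F (v + x)%R + ((1 - e) / 2)%:E * F (v - x)%R ;
  two_point_gauss : forall v x,
    2^-1%:E * F (v + x)%R + 2^-1%:E * F (v - x)%R <= gauss_avg x F v }.

(** The two inequalities hold at every displaced point, and averaging over the
    displacement preserves them; the second also needs that averages in different
    directions commute. *)
Lemma two_point_gauss_avg y F : two_point F -> two_point (gauss_avg y F).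
Proof.
move=> [bF F0 Fchord Fgauss].
have line v : measurable_fun setT (fun z : mR => F (v + (z : R) *: y)%R).
  exact: borel_line.
have split_int (a b : R) v w : (0 <= a)%R -> (0 <= b)%R ->
    \int[gauss]_z (a%:E * F (v + z *: y)%R + b%:E * F (w + z *: y)%R) =
    a%:E * gauss_avg y F v + b%:E * gauss_avg y F w.
  move=> a0 b0; rewrite ge0_integralD//; last 4 first.
  - by move=> z _; rewrite mule_ge0.
  - exact: measurable_funeM.
  - by move=> z _; rewrite mule_ge0.
  - exact: measurable_funeM.
  by rewrite !ge0_integralZl.
have mcomb (a b : R) v w : measurable_fun setT (fun z : mR =>
    a%:E * F (v + (z : R) *: y)%R + b%:E * F (w + (z : R) *: y)%R).
  by apply: emeasurable_funD; exact: measurable_funeM.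
split.
- exact: gauss_avg_borel.
- by move=> v; exact: gauss_avg_ge0.
- move=> v x e e1; have /andP[eN1 e1'] : (-1 <= e <= 1)%R by rewrite -ler_norml.
  rewrite -split_int; [|lra|lra]; apply: ge0_le_integral => //.
  move=> z _; rewrite addrAC (addrAC v x) (addrAC v (- x)%R).
  exact: Fchord.
- move=> v x; rewrite gauss_avgC//.
  rewrite -split_int; [|by rewrite invr_ge0 ler0n|by rewrite invr_ge0 ler0n].
  apply: ge0_le_integral => //.
  + by move=> z _; rewrite adde_ge0// mule_ge0// lee_fin invr_ge0 ler0n.
  + apply: borel_line; exact: gauss_avg_borel.
  move=> z _; rewrite (addrAC v x) (addrAC v (- x)%R).
  exact: Fgauss.
Qed.

(** The second moment is one, so the mean of the parabola on the left is its value
    [m] at the points one and minus one. *)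
Lemma gauss_tangent (m c : R) (g : mR -> R) : (0 <= m)%R -> (0 <= c)%R ->
  measurable_fun setT g -> (forall z, (0 <= g z)%R) ->
  (forall z : R, (m + c * (z ^+ 2 - 1) <= g z)%R) ->
  m%:E <= \int[gauss]_z (g z)%:E.
Proof.
move=> m0 c0 mg g0 gm.
have cst (k : R) : \int[gauss]_z k%:E = k%:E.
  exact: (integral_probability_cst (normal_prob 0 1) k%:E).
have msq : measurable_fun setT (fun z : mR => (z ^+ 2)%:E).
  by apply/measurable_EFinP; exact: measurable_funX.
have sq0 (z : mR) : 0 <= (z ^+ 2)%:E by rewrite lee_fin sqr_ge0.
rewrite -(@leeD2rE _ c%:E)//.
rewrite -[in leLHS](cst m) -[in leLHS](mule1 c%:E) -standard_normal_variance.
rewrite -[in leRHS](cst c) -ge0_integralZl//.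
have mg' : measurable_fun setT (fun z => (g z)%:E) by exact/measurable_EFinP.
have g0' z : 0 <= (g z)%:E by rewrite lee_fin.
have csq0 (z : mR) : 0 <= c%:E * (z ^+ 2)%:E by rewrite mule_ge0.
have mcsq : measurable_fun setT (fun z : mR => c%:E * (z ^+ 2)%:E).
  exact: measurable_funeM.
rewrite -!ge0_integralD//.
apply: ge0_le_integral => //.
- by move=> z _; rewrite adde_ge0.
- exact: emeasurable_funD.
- exact: emeasurable_funD.
by move=> z _; rewrite -EFinM -!EFinD lee_fin; have := gm z; lra.
Qed.

Lemma gauss_avg_sym x F v : borel_fun F -> (forall w, 0 <= F w) ->
  gauss_avg x F v = \int[gauss]_z
    (2^-1%:E * F (v + z *: x)%R + 2^-1%:E * F (v - z *: x)%R).
Proof.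
move=> bF F0.
have h0 : (0 <= 2^-1 :> R)%R by rewrite invr_ge0 ler0n.
have lineN : measurable_fun setT (fun z : mR => F (v - (z : R) *: x)%R).
  by under eq_fun do rewrite -scalerN; exact: borel_line.
have lineP : measurable_fun setT (fun z : mR => F (v + (z : R) *: x)%R).
  exact: borel_line.
have hF0 w : 0 <= 2^-1%:E * F w by rewrite mule_ge0// lee_fin.
have mP := measurable_funeM 2^-1%:E lineP.
have mN := measurable_funeM 2^-1%:E lineN.
rewrite ge0_integralD// !ge0_integralZl//.
under [in X in _ + _ * X]eq_integral do rewrite -scalerN.
rewrite -/(gauss_avg (- x) F v) gauss_avg_opp// -/(gauss_avg x F v).
rewrite -ge0_muleDl ?lee_fin// -EFinD (_ : 2^-1 + 2^-1 = 1)%R ?mul1e//.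
by field.
Qed.

(** The chord inequality at the midpoint forces the slope [c] of the tangent to be
    nonnegative, as [gauss_tangent] requires. *)
Lemma two_point_of_tangent (g : V -> R) : borel_fun (EFin \o g) ->
  (forall v, (0 <= g v)%R) ->
  (forall v x (e : R), (`|e| <= 1)%R ->
    (g (v + e *: x) <= (1 + e) / 2 * g (v + x) + (1 - e) / 2 * g (v - x))%R) ->
  (forall v x, exists c, forall z : R,
    (g (v + x) + g (v - x) + c * (z ^+ 2 - 1) <= g (v + z *: x) + g (v - z *: x))%R) ->
  two_point (EFin \o g).
Proof.
move=> bg g0 gchord gtan; split => //.
move=> v x; rewrite gauss_avg_sym//; have [c cP] := gtan v x.
have c0 : (0 <= c)%R.
  have := gchord v x 0%R; rewrite normr0 scale0r !addr0 subr0 => /(_ ler01).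
  have := cP 0%R; rewrite scale0r !addr0 subr0 expr0n/=; lra.
under eq_integral do rewrite -!EFinM -EFinD.
rewrite -!EFinM -EFinD; apply: (@gauss_tangent _ (c / 2)).
- by rewrite addr_ge0// mulr_ge0// invr_ge0 ler0n.
- by rewrite divr_ge0.
- have mP : measurable_fun setT (fun z : mR => g (v + (z : R) *: x)%R).
    by apply/measurable_EFinP; exact: (borel_line v x bg).
  have mN : measurable_fun setT (fun z : mR => g (v - (z : R) *: x)%R).
    apply/measurable_EFinP; under eq_fun do rewrite -scalerN.
    exact: (borel_line v (- x) bg).
  by apply: measurable_funD; apply: measurable_funM.
- by move=> z; rewrite addr_ge0// mulr_ge0// invr_ge0 ler0n.
- by move=> z; have := cP z; lra.
Qed.

Lemma borel_square : borel_fun (fun v => (dot v v)%:E).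
Proof. by apply: (@borel_dot R n EFin); apply/measurable_EFinP. Qed.

Lemma two_point_square : two_point (fun v => (dot v v)%:E).
Proof.
apply: (@two_point_of_tangent (fun v => dot v v)).
- exact: borel_square.
- exact: dot_ge0.
- move=> v x e; rewrite ler_norml => /andP[eN1 e1].
  rewrite -[(- x)%R]scaleN1r !dotDl !dotDr !dotZl !dotZr (dotC x v).
  rewrite -subr_ge0; set d := (X in (0 <= X)%R).
  have -> : (d = (1 + e) * (1 - e) * dot x x)%R by rewrite /d; field.
  by rewrite !mulr_ge0 ?dot_ge0//; lra.
- move=> v x; exists (2 * dot x x)%R => z.
  rewrite -!scaleNr -[(- x)%R]scaleN1r !dotDl !dotDr !dotZl !dotZr (dotC x v).
  by rewrite le_eqVlt; apply/orP; left; apply/eqP; ring.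
Qed.

Lemma gauss_avgs_square xs v : gauss_avgs xs (fun w => (dot w w)%:E) v =
  (dot v v + \sum_(x <- xs) dot x x)%:E.
Proof.
elim: xs v => [|x xs IH] v /=; first by rewrite big_nil addr0.
have -> : gauss_avgs xs (fun w => (dot w w)%:E) =
    fun w => (dot w w + \sum_(x <- xs) dot x x)%:E by exact/funext.
set k := (\sum_(x <- xs) dot x x)%R.
have k0 : (0 <= k)%R by rewrite sumr_ge0// => y _; exact: dot_ge0.
have bk : borel_fun (fun w => (dot w w + k)%:E).
  apply: (@borel_dot R n (fun s => (s + k)%:E)); apply/measurable_EFinP.
  exact: measurable_funD.
have k0' w : 0 <= (dot w w + k)%:E by rewrite lee_fin addr_ge0// dot_ge0.
rewrite gauss_avg_sym//.
transitivity (\int[gauss]_z ((dot v v + k)%:E + (dot x x)%:E * ((z : mR) ^+ 2)%:E)).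
  apply: eq_integral => z _; rewrite -!EFinM -!EFinD; congr EFin.
  by rewrite -!scaleNr !dotDl !dotDr !dotZl !dotZr (dotC x v); field.
have msq : measurable_fun setT (fun z : mR => (z ^+ 2)%:E).
  by apply/measurable_EFinP; exact: measurable_funX.
have sq0 (z : mR) : 0 <= (z ^+ 2)%:E by rewrite lee_fin sqr_ge0.
have x0 : 0 <= (dot x x)%:E by rewrite lee_fin dot_ge0.
have xsq0 (z : mR) : 0 <= (dot x x)%:E * (z ^+ 2)%:E by rewrite mule_ge0.
have mxsq := measurable_funeM (dot x x)%:E msq.
rewrite ge0_integralD// ge0_integralZl//.
rewrite standard_normal_variance mule1 big_cons.
have -> : \int[gauss]_z (dot v v + k)%:E = (dot v v + k)%:E.
  exact: (integral_probability_cst (normal_prob 0 1) (dot v v + k)%:E).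
by rewrite -EFinD; congr EFin; rewrite /k; ring.
Qed.

End two_point_class.

Section radial_two_point.
Context {R : realType} {n : nat} (f f1 f2 : R -> R).
Context (f_even : forall x, f (- x) = f x)
  (df : forall x : R, is_derive x 1 f (f1 x))
  (df1 : forall x : R, is_derive x 1 f1 (f2 x))
  (f2_even : forall x, f2 (- x) = f2 x)
  (f1_0 : f1 0 = 0)
  (f2_convex : forall t x y : R, 0 <= t -> t <= 1 ->
     f2 (t * x + (1 - t) * y) <= t * f2 x + (1 - t) * f2 y)
  (f2_0 : 0 <= f2 0) (f_0 : 0 <= f 0).
Local Notation V := 'cV[R]_n.

Let F (v : V) : \bar R := (f (Num.sqrt (dot v v)))%:E.

(* along a line the squared length is the square of the displacement from the
   foot of the perpendicular, up to a constant *)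
Let foot (v x : V) : exists q b s, 0 <= q /\ forall e : R,
  F (v + e *: x) = (radial f q (b + e * s))%:E.
Proof.
have [x0|x0] := eqVneq (dot x x) 0.
  exists (dot v v), 0, 0; split; first exact: dot_ge0.
  move=> e; move/eqP: x0; rewrite dot_eq0 => /eqP ->.
  by rewrite scaler0 addr0 /F /radial mulr0 addr0 expr0n addr0.
pose s := Num.sqrt (dot x x).
have s2 : s ^+ 2 = dot x x by rewrite sqr_sqrtr// dot_ge0.
have s0 : s != 0 by rewrite -sqrf_eq0 s2.
pose b := dot v x / s; pose w := v - (dot v x / dot x x) *: x.
exists (dot w w), b, s; split; first exact: dot_ge0.
move=> e; rewrite /F /radial; congr (f (Num.sqrt _))%:E.
rewrite /w -scaleNr !dotDl !dotDr !dotZl !dotZr (dotC x v) /b -s2.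
by field.
Qed.

Lemma radial_two_point : two_point F.
Proof.
have f_ge0 x : 0 <= x -> 0 <= f x.
  by move=> x0; apply: le_trans f_0 (even_mono df df1 f2_even f1_0 f2_convex f2_0 _ x0).
have mf : measurable_fun [set: R] f.
  apply: continuous_measurable_fun => x; apply: differentiable_continuous.
  by apply/derivable1_diffP; have [] := df x.
have bF : borel_fun F.
  apply: (@borel_dot R n (fun s => (f (Num.sqrt s))%:E)).
  apply/measurable_EFinP; apply: (measurableT_comp mf).
  by apply: continuous_measurable_fun; exact: sqrt_continuous.
have F0 v : (0 <= F v)%E by rewrite lee_fin f_ge0// sqrtr_ge0.
apply: (@two_point_of_tangent R n (fun v => f (Num.sqrt (dot v v)))) => //.
- move=> v x e e1; have [q [b [s [q0 FE]]]] := foot v x.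
  have := radial_chord df df1 f2_even f1_0 f2_convex f2_0 b s q0 e1.
  have := FE e; have := FE 1; have := FE (- 1).
  by rewrite scale1r scaleN1r mul1r mulN1r => -[->] [->] [->].
move=> v x; have [q [b [s [q0 FE]]]] := foot v x.
have [c cP] := radial_square_tangent f_even df df1 f2_even f1_0 f2_convex b s q0.
exists c => z; have := cP z; have := FE z; have := FE (- z).
have := FE 1; have := FE (- 1).
by rewrite scale1r scaleN1r mul1r mulN1r scaleNr mulNr => -[->] [->] [->] [->].
Qed.

End radial_two_point.

(** * Independent variables *)

Section independence.
Context d (T : measurableType d) (R : realType) (P : probability T R)
  (I : finType) (X : I -> {RV P >-> R}).
Context (indX : mutually_independent X).
Local Open Scope ereal_scope.

(** A system of sets that is stable under intersection and generates the
    sigma-algebra of the variables with index in [J]. *)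
Definition cylinders (J : {set I}) : set (set T) :=
  [set A | exists2 B : I -> set R, forall i, measurable (B i) &
    A = \bigcap_(i in [set` J]) (X i @^-1` B i)].

Lemma cylinders_measurable J : cylinders J `<=` measurable.
Proof.
move=> _ [B mB ->]; apply: fin_bigcap_measurable => [|i _].
  exact: finite_finset.
exact: measurable_funPTI.
Qed.

Lemma cylinders_setI J : setI_closed (cylinders J).
Proof.
move=> _ _ [B mB ->] [C mC ->]; exists (fun i => B i `&` C i).
  by move=> i; exact: measurableI.
rewrite -bigcapI; apply: eq_bigcapr => i _; exact/esym/preimage_setI.
Qed.

Lemma cylinders_setT J : cylinders J setT.
Proof.
exists (fun=> setT) => //.
by apply/esym/seteqP; split.
Qed.

Lemma cylinder_indep (J : {set I}) k (A : set T) (B : set R) : k \notin J -> cylinders J A ->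
  measurable B -> P (A `&` X k @^-1` B) = P A * P (X k @^-1` B).
Proof.
move=> kJ [C mC ->] mB.
pose C' i := if i == k then B else C i.
have mC' i : measurable (C' i) by rewrite /C'; case: ifP.
have JE : \bigcap_(i in [set` J]) (X i @^-1` C i) =
    \bigcap_(i in [set` J]) (X i @^-1` C' i).
  apply: eq_bigcapr => i /= iJ; rewrite /C'; case: eqP => // ik.
  by move: kJ; rewrite -ik iJ.
have kJE : \bigcap_(i in [set` J]) (X i @^-1` C i) `&` X k @^-1` B =
    \bigcap_(i in [set` k |: J]) (X i @^-1` C' i).
  rewrite JE; apply/seteqP; split => t /=.
    move=> [tJ tk] i /=; rewrite !inE => /predU1P[->|/tJ//].
    by rewrite /C' eqxx.
  move=> tkJ; split; last by have := tkJ k; rewrite /C' eqxx; apply; rewrite /= !inE eqxx.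
  by move=> i iJ; apply: tkJ; rewrite /= !inE; apply/orP; right.
rewrite kJE JE !indX// big_setU1//= muleC; congr (_ * _).
by rewrite /C' eqxx.
Qed.

(** Both sides are finite measures in [A] that agree on the cylinders. *)
Lemma sigma_cylinder_indep (J : {set I}) k (A : set T) (B : set R) : k \notin J ->
  <<s cylinders J >> A -> measurable B ->
  P (A `&` X k @^-1` B) = P A * P (X k @^-1` B).
Proof.
move=> kJ sA mB.
have mXB : measurable (X k @^-1` B) by exact: measurable_funPTI.
have p0 : (0 <= fine (P (X k @^-1` B)))%R by exact: fine_ge0.
have pE : P (X k @^-1` B) = (NngNum p0)%:num%:E.
  by rewrite /= fineK// fin_num_measure.
rewrite [RHS]muleC pE.
apply: (@g_sigma_algebra_measure_unique _ _ _ (cylinders J)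
  (@cylinders_measurable J) (fun=> setT) _ _
  (mrestr P mXB) (mscale (NngNum p0) P) (@cylinders_setI J)) => //.
- by move=> _; exact: cylinders_setT.
- by rewrite bigcup_const//; exists 0%N.
- move=> C cC.
  transitivity (P (C `&` X k @^-1` B)) => //.
  transitivity ((NngNum p0)%:num%:E * P C) => //; rewrite -pE muleC.
  exact: cylinder_indep cC mB.
- move=> _; apply: (@le_lt_trans _ _ 1); last exact: ltry.
  by apply: probability_le1; exact: measurableI.
Qed.

(* the sample space with the sigma-algebra generated by the variables in [J] *)
Notation TJ J := (g_sigma_algebraType (cylinders J)).

Let idJ J : T -> TJ J := id.

Let measurable_idJ J : measurable_fun setT (idJ J).
Proof.
move=> _ A sA; rewrite setTI preimage_id.
by apply: smallest_sub sA; [exact: sigma_algebra_measurable|exact: cylinders_measurable].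
Qed.

HB.instance Definition _ J :=
  isMeasurableFun.Build _ _ _ _ (idJ J) (@measurable_idJ J).

Lemma measurable_RV_cylinders (J : {set I}) i : i \in J ->
  measurable_fun setT (X i : TJ J -> R).
Proof.
move=> iJ _ B mB; rewrite setTI; apply: sub_sigma_algebra.
exists (fun j => if j == i then B else setT); first by move=> j; case: ifP.
apply/seteqP; split => t /=.
  by move=> tB j /= _; case: eqP => // ->.
by move=> /(_ i iJ)/=; rewrite eqxx.
Qed.

(** The point of the sample space, observed through the variables with index in
    [J], and the variable [X k] have a product law, so that Fubini's theorem
    applies. *)
Lemma ge0_integral_indep (J : {set I}) k (Phi : TJ J * R -> \bar R) : k \notin J ->
  measurable_fun setT Phi -> (forall p, 0 <= Phi p) ->
  \int[P]_t Phi (t, X k t) = \int[P]_t \int[distribution P (X k)]_y Phi (t, y).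
Proof.
move=> kJ mPhi Phi0.
pose h0 t : (TJ J * R)%type := (idJ J t, X k t).
have mh : measurable_fun setT h0.
  apply: measurable_fun_pair; first exact: measurable_idJ.
  exact: measurable_funP.
pose h : {mfun T >-> (TJ J * R)%type} :=
  HB.pack h0 (isMeasurableFun.Build _ _ _ _ _ mh).
rewrite -[LHS](@ge0_integral_distribution _ _ _ _ _ _ h)//.
transitivity (\int[(distribution P (idJ J) \x distribution P (X k))]_p Phi p).
  apply: eq_measure_integral => A mA _; apply/esym.
  apply: product_measure_unique => // C B mC mB.
  exact: (sigma_cylinder_indep kJ mC mB).
rewrite fubini_tonelli1//.
rewrite ge0_integral_distribution//.
- exact: measurable_fun_fubini_tonelli_F.
- by move=> t; exact: integral_ge0.
Qed.

End independence.

(** * Replacing bounded centred variables by normal ones *)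

Section rademacher_comparison.
Context d (T : measurableType d) (R : realType) (P : probability T R) (n m : nat)
  (eta : 'I_n -> {RV P >-> R}) (x : 'I_n -> 'cV[R]_m).
Context (ind_eta : mutually_independent eta)
  (eta_mean : forall i, ('E_P[eta i] = 0)%E)
  (eta_le1 : forall i, {ae P, forall w, `|eta i w| <= 1}).
Local Open Scope ereal_scope.
Notation V := 'cV[R]_m.
Implicit Types (F : V -> \bar R) (u v : V) (k : 'I_n).

Lemma bounded_integrable k : P.-integrable setT (EFin \o eta k).
Proof.
apply/integrableP; split; first exact/measurable_EFinP.
apply: (@le_lt_trans _ _ (\int[P]_w cst 1 w)).
  apply: ae_ge0_le_integral => //.
  - by apply: measurableT_comp => //; exact/measurable_EFinP.
  - by apply: filterS (eta_le1 k) => w h _; rewrite /= lee_fin.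
by rewrite integral_probability_cst ltry.
Qed.

(** The weight of an end point of the interval [-1, 1] in the expression of a
    point as a combination of both; truncation keeps it nonnegative outside. *)
Definition weight (e y : R) : R := Num.max 0%R ((1 + e * y) / 2)%R.

Lemma measurable_weight e : measurable_fun setT (weight e).
Proof.
apply: measurable_maxr => //; apply: measurable_funM => //.
by apply: measurable_funD => //; apply: measurable_funM.
Qed.

Lemma weight_ge0 e y : (0 <= weight e y)%R.
Proof. by rewrite le_max lexx. Qed.

Lemma weightE e y : (`|e| = 1)%R -> (`|y| <= 1)%R -> weight e y = ((1 + e * y) / 2)%R.
Proof.
move=> e1 y1; apply/max_idPr; rewrite divr_ge0//.
have : (`|e * y| <= 1)%R by rewrite normrM e1 mul1r.
by rewrite ler_norml => /andP[]; lra.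
Qed.

Lemma integral_weight e k : (`|e| = 1)%R ->
  \int[P]_w (weight e (eta k w))%:E = 2^-1%:E.
Proof.
move=> e1.
transitivity (\int[P]_w (2^-1%:E + (e / 2)%:E * (eta k w)%:E)).
  apply: ae_eq_integral => //.
  - apply/measurable_EFinP; apply: (measurableT_comp (measurable_weight e)).
    exact: measurable_funP.
  - apply: emeasurable_funD => //; apply: measurable_funeM.
    exact/measurable_EFinP.
  - apply: filterS (eta_le1 k) => w h _.
    by rewrite weightE// -EFinM -EFinD; congr EFin; field.
have int_eta := bounded_integrable k.
rewrite integralD//; last 2 first.
- exact: finite_measure_integrable_cst.
- exact: integrableZl.
rewrite integralZl//.
have -> : \int[P]_w (eta k w)%:E = 0.
  by have := eta_mean k; rewrite unlock.
by rewrite mule0 adde0 (integral_probability_cst P).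
Qed.

(** A point of the interval [-1, 1] is the combination of its end points with
    weights of mean one half, and [F] satisfies the chord inequality. *)
Lemma integral_law_le k F u v : two_point F ->
  \int[distribution P (eta k)]_y F (u + y *: v)%R <=
    2^-1%:E * F (u + v)%R + 2^-1%:E * F (u - v)%R.
Proof.
move=> tF; have [bF F0 Fchord _] := tF.
have mFl : measurable_fun setT (fun y : R => F (u + y *: v)%R) by exact: borel_line.
rewrite ge0_integral_distribution//.
have mW e : measurable_fun setT (fun w => (weight e (eta k w))%:E).
  apply/measurable_EFinP; apply: (measurableT_comp (measurable_weight e)).
  exact: measurable_funP.
have W0 e w : 0 <= (weight e (eta k w))%:E by rewrite lee_fin weight_ge0.
have WF0 e w z : 0 <= (weight e (eta k w))%:E * F z by rewrite mule_ge0.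
have mWF e z : measurable_fun setT (fun w => (weight e (eta k w))%:E * F z).
  by apply: emeasurable_funM.
pose B w := (weight 1 (eta k w))%:E * F (u + v)%R +
  (weight (-1) (eta k w))%:E * F (u - v)%R.
apply: (@le_trans _ _ (\int[P]_w B w)).
  apply: ae_ge0_le_integral => //.
  - by move=> w _; exact: F0.
  - by apply: (measurableT_comp mFl); exact: measurable_funP.
  - by move=> w _; rewrite adde_ge0.
  - exact: emeasurable_funD.
  apply: filterS (eta_le1 k) => w h _.
  by rewrite /B !weightE ?normrN1 ?normr1// mul1r mulN1r Fchord.
rewrite ge0_integralD// !ge0_integralZr//.
by rewrite !integral_weight ?normrN1 ?normr1.
Qed.

Lemma coord_measurable_sum d' (T' : measurableType d') (g : T' -> T)
    (s : seq 'I_n) :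
  (forall i, i \in s -> measurable_fun setT (fun w => eta i (g w))) ->
  coord_measurable (fun w => \sum_(i <- s) eta i (g w) *: x i)%R.
Proof.
elim: s => [_|i s IH mg].
  by under eq_fun do rewrite big_nil; exact: coord_measurable_cst.
under eq_fun do rewrite big_cons.
apply: coord_measurableD; first by apply: coord_measurableZ; apply: mg; exact: mem_head.
by apply: IH => j js; apply: mg; rewrite inE js orbT.
Qed.

(** Induction on the number of variables, from the last to the first: given the
    other variables, the last one is replaced at the price of replacing [F] by its
    Gaussian average, which is in the same class. *)
Lemma integral_sum_le (s : seq 'I_n) F : uniq s -> two_point F ->
  \int[P]_w F (\sum_(i <- s) eta i w *: x i)%R <=
    gauss_avgs [seq x i | i <- s] F 0%R.
Proof.
elim/last_ind: s F => [|s k IH] F.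
  move=> _ tF /=; under eq_integral do rewrite big_nil.
  by rewrite (integral_probability_cst P).
rewrite rcons_uniq => /andP[ks us] tF.
have [bF F0 _ Fgauss] := tF.
rewrite map_rcons /gauss_avgs foldr_rcons -/(gauss_avgs _ _).
apply: le_trans (IH _ us (two_point_gauss_avg (x k) tF)).
pose J := [set i in s]; pose U w : V := (\sum_(i <- s) eta i w *: x i)%R.
have kJ : k \notin J by rewrite inE.
pose Phi (p : g_sigma_algebraType (cylinders eta J) * R) :=
  F (U p.1 + p.2 *: x k)%R.
have mPhi : measurable_fun setT Phi.
  apply: bF; apply: coord_measurableD; last exact: coord_measurableZ.
  apply: (@coord_measurable_sum _
    (g_sigma_algebraType (cylinders eta J) * R)%type (fun p => p.1) s) => i si.
  have iJ : i \in J by rewrite inE.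
  exact: (measurableT_comp (measurable_RV_cylinders (X := eta) iJ)
    (@measurable_fst _ _ (g_sigma_algebraType (cylinders eta J)) R)).
have mUT : coord_measurable U.
  by apply: (@coord_measurable_sum _ T id s) => i _; exact: measurable_funP.
have -> : \int[P]_w F (\sum_(i <- rcons s k) eta i w *: x i)%R =
    \int[P]_w Phi (w, eta k w).
  by apply: eq_integral => w _; rewrite -cats1 big_cat big_seq1.
rewrite ge0_integral_indep//; last by move=> p; exact: F0.
apply: ge0_le_integral => //.
- by move=> w _; apply: integral_ge0 => y _; exact: F0.
- apply: (measurable_fun_fubini_tonelli_F (m2 := distribution P (eta k))
    (fun p : T * R => F (U p.1 + p.2 *: x k)%R)) => //.
  apply: bF; apply: coord_measurableD; last exact: coord_measurableZ.
  exact: coord_measurable_comp.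
- exact: (@gauss_avg_borel _ _ (x k) F bF F0 _ _ U mUT).
move=> w _.
exact: le_trans (@integral_law_le k F (U w) (x k) tF) (Fgauss (U w) (x k)).
Qed.

End rademacher_comparison.

(** * Decomposition of even functions *)

Section even_functions.
Context {R : realType} (f : R -> R).

Lemma C2_conv_is_derive : C2_conv f ->
  (forall x : R, is_derive x 1 f (f^`()%classic x)) /\
  (forall x : R, is_derive x 1 (f^`())%classic (f^`(2)%classic x)).
Proof.
move=> [_ df ddf _]; split=> x.
  by rewrite derive1E; exact: derivableP.
by rewrite derive1nS derive1n1 derive1E; exact: derivableP.
Qed.

Lemma is_derive_inj F (x : R) (a b : R) :
  is_derive x 1 F a -> is_derive x 1 F b -> a = b.
Proof. by move=> [_ <-] [_ <-]. Qed.

Lemma derive_odd (F dF : R -> R) : (forall x, F (- x) = F x) ->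
  (forall x : R, is_derive x 1 F (dF x)) -> forall x, dF (- x) = - dF x.
Proof.
move=> Feven dFE x.
have := is_derive_affine_comp 0 (- 1) x dFE.
under eq_fun do rewrite add0r mulN1r Feven.
by rewrite add0r mulN1r => /(is_derive_inj (dFE x)) ->; rewrite mulN1r opprK.
Qed.

Lemma derive_even (F dF : R -> R) : (forall x, F (- x) = - F x) ->
  (forall x : R, is_derive x 1 F (dF x)) -> forall x, dF (- x) = dF x.
Proof.
move=> Fodd dFE x.
have := is_derive_affine_comp 0 (- 1) x dFE.
under eq_fun do rewrite add0r mulN1r Fodd.
rewrite add0r mulN1r => h.
have := is_deriveZ1 (- 1) (dFE x); under eq_fun do rewrite mulN1r.
by move=> /(is_derive_inj h); rewrite !mulN1r => /oppr_inj.
Qed.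

Lemma C2_conv_convex : C2_conv f -> forall t x y : R, 0 <= t -> t <= 1 ->
  f^`(2)%classic (t * x + (1 - t) * y) <=
  t * f^`(2)%classic x + (1 - t) * f^`(2)%classic y.
Proof.
move=> [_ _ _ cvx] t x y t0 t1.
have := cvx (Itv01 t0 t1) x y (in_setT _) (in_setT _).
by rewrite !convRE.
Qed.

Lemma C2_up_ge0 : C2_up_conv f -> forall x, 0 <= x -> 0 <= f x.
Proof.
move=> [cf f0 f20] x x0; have [df df1] := C2_conv_is_derive cf.
have [f_even _ _ _] := cf.
have f1_odd := derive_odd f_even df.
have f1_0 : f^`()%classic 0 = 0.
  by have := f1_odd 0; rewrite oppr0; lra.
exact: le_trans f0 (even_mono df df1 (derive_even f1_odd df1) f1_0
  (C2_conv_convex cf) f20 (lexx 0) x0).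
Qed.

Lemma C2_up_two_point n : C2_up_conv f ->
  two_point (fun v : 'cV[R]_n => (f (Num.sqrt (dot v v)))%:E).
Proof.
move=> [cf f0 f20]; have [df df1] := C2_conv_is_derive cf.
have [f_even _ _ _] := cf.
have f1_odd := derive_odd f_even df.
have f1_0 : f^`()%classic 0 = 0.
  by have := f1_odd 0; rewrite oppr0; lra.
exact: (radial_two_point f_even df df1 (derive_even f1_odd df1) f1_0
  (C2_conv_convex cf) f20 f0).
Qed.

Lemma C2_conv_measurable : C2_conv f -> measurable_fun [set: R] f.
Proof.
move=> [_ df _ _]; apply: continuous_measurable_fun => x.
by apply: differentiable_continuous; exact/derivable1_diffP.
Qed.

(** Subtracting the value at zero, and the quadratic Taylor term when it is
    negative, leaves a function that is nonnegative and convex. *)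
Lemma C2_conv_split : C2_conv f -> exists2 c : R, c <= 0 &
  C2_up_conv (fun x => f x - f 0 - c * x ^+ 2).
Proof.
move=> cf; have [df df1] := C2_conv_is_derive cf; have [f_even _ _ f2c] := cf.
pose c := Num.min (f^`(2)%classic 0) 0 / 2.
pose g x := f x - f 0 - c * x ^+ 2.
have dg (x : R) : is_derive x 1 g (f^`()%classic x + - (2 * c) * x).
  have := is_deriveD1 (df x) (is_derive_quadratic (- f 0) (- c) x).
  have -> : (fun t => f t + (- f 0 + - c * t ^+ 2)) = g.
    by apply/funext => t; rewrite /g; ring.
  by move=> /is_derive_eq; apply; ring.
have g1E : g^`()%classic = fun x => f^`()%classic x + - (2 * c) * x.
  by apply/funext => x; rewrite derive1E; have [_ ->] := dg x.
have dg1 (x : R) : is_derive x 1 (g^`()%classic) (f^`(2)%classic x - 2 * c).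
  rewrite g1E; have := is_deriveD1 (df1 x) (is_derive_affine 0 (- (2 * c)) x).
  by under eq_fun do rewrite add0r.
have g2E : g^`(2)%classic = fun x => f^`(2)%classic x - 2 * c.
  by apply/funext => x; rewrite derive1nS derive1n1 derive1E; have [_ ->] := dg1 x.
exists c; first by rewrite /c mulr_le0_ge0 ?invr_ge0// ge_min lexx orbT.
split; last 2 first.
- by rewrite -/g /g expr0n mulr0 subr0 subrr.
- by rewrite -/g g2E subr_ge0 /c mulrC divfK ?pnatr_eq0// ge_min lexx.
split.
- by move=> x; rewrite f_even sqrrN.
- by move=> x; have [] := dg x.
- by move=> x; have [] := dg1 x.
rewrite -/g g2E => t x y _ _; have := f2c t x y (in_setT _) (in_setT _).
rewrite !convRE /unstable.onem.
move: (t%:inum) (f^`(2)%classic _) (f^`(2)%classic x) (f^`(2)%classic y).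
by move=> u a1 a2 a3; lra.
Qed.

End even_functions.

Section quadratic_shift.
Context d (T : measurableType d) (R : realType) (P : probability T R).
Local Open Scope ereal_scope.

(** Additivity also when the integral of [g] is infinite: the positive part of the
    sum then has an infinite integral and its negative part, bounded by the modulus
    of [q], a finite one. *)
Lemma ge0_integralD_integrable (g q : T -> R) :
  measurable_fun setT g -> (forall w, (0 <= g w)%R) ->
  P.-integrable setT (EFin \o q) ->
  \int[P]_w (g w + q w)%:E = \int[P]_w (g w)%:E + \int[P]_w (q w)%:E.
Proof.
move=> mg g0 iq.
have mq : measurable_fun setT q by exact/measurable_EFinP/(measurable_int P).
have mgE : measurable_fun setT (fun w => (g w)%:E) by exact/measurable_EFinP.
have [goo|] := ltP (\int[P]_w (g w)%:E) +oo.
  under eq_integral do rewrite EFinD.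
  rewrite integralD//; apply/integrableP; split => //.
  by under eq_integral do rewrite gee0_abs// ?lee_fin//.
rewrite leye_eq => /eqP goo; rewrite goo.
have qfin : \int[P]_w (q w)%:E \is a fin_num by exact: integrable_fin_num.
have qNy : \int[P]_w (q w)%:E != -oo by move: qfin; rewrite fin_numE => /andP[].
rewrite addye//.
have absq : \int[P]_w `|(q w)%:E| < +oo by have /integrableP[] := iq.
pose F w := (g w + q w)%:E.
have mF : measurable_fun setT F by apply/measurable_EFinP; exact: measurable_funD.
have maq : measurable_fun setT (fun w => `|(q w)%:E|).
  by apply: measurableT_comp => //; exact/measurable_EFinP.
have FE : F = (EFin \o (fun w => g w + q w)%R) by [].
have pos : \int[P]_w F^\+ w = +oo.
  apply/eqP; rewrite -leye_eq -goo.
  have : \int[P]_w (g w)%:E <= \int[P]_w F^\+ w + \int[P]_w `|(q w)%:E|.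
    rewrite -ge0_integralD//; last exact: measurable_funepos.
    apply: ge0_le_integral => //.
    - by move=> w _; rewrite lee_fin.
    - by apply: emeasurable_funD => //; exact: measurable_funepos.
    - move=> w _; rewrite funeposE /F -EFin_max -EFinD lee_fin.
      have := ler_norm (- q w); rewrite normrN.
      have : (g w + q w <= Num.max (g w + q w) 0)%R by rewrite le_max lexx.
      lra.
  rewrite goo; move: absq; move: (\int[P]_w `|_|) (\int[P]_w F^\+ w).
  by case=> [a||] [b||].
rewrite -[LHS]/(\int[P]_w F w) integralE pos.
have neg : \int[P]_w F^\- w < +oo.
  apply: le_lt_trans absq; apply: ge0_le_integral => //.
  - exact: measurable_funeneg.
  - move=> w _; rewrite funenegE /F -EFinN -EFin_max lee_fin ge_max normr_ge0 andbT.
    by have := ler_norm (- q w); rewrite normrN; have := g0 w; lra.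
have neg0 : 0 <= \int[P]_w F^\- w by exact: integral_ge0.
by move: neg neg0; case: (\int[P]_w F^\- w).
Qed.

End quadratic_shift.

(** * Quadratic forms of orthoprojectors *)

Section orthoprojectors.
Context {R : realType} {n : nat} (M : 'M[R]_n).
Hypothesis hM : orthoprojector M.

Lemma quad_form_orthoprojector v : quad_form M v = dot (M *m v) (M *m v).
Proof.
have [MT MM] := hM.
by rewrite /quad_form /dot trmx_mul MT !mulmxA -(mulmxA _ M M) MM.
Qed.

Lemma mulmx_col_sum (e : 'I_n -> R) :
  M *m \col_i e i = \sum_(i <- index_enum 'I_n) e i *: col i M.
Proof.
apply/colP => j; rewrite mxE summxE; apply: eq_bigr => i _.
by rewrite !mxE mulrC.
Qed.

Lemma gram_col_orthoprojector : gram [seq col i M | i <- index_enum 'I_n] = M.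
Proof.
have [MT MM] := hM.
rewrite /gram big_map -[RHS]MM -[X in _ = _ *m X]MT.
apply/matrixP => i j; rewrite summxE mxE; apply: eq_bigr => k _.
by rewrite mxE big_ord_recl big_ord0 addr0 !mxE.
Qed.

(** In a rank factorization of an idempotent matrix the product of the factors in
    the other order is the identity. *)
Lemma mxtrace_orthoprojector : \tr M = (\rank M)%:R.
Proof.
have [_ MM] := hM.
have RC : row_base M *m col_base M = 1%:M.
  apply: (row_free_inj (row_base_free M)); rewrite mul1mx.
  have /row_full_inj := col_base_full M; apply.
  transitivity ((col_base M *m row_base M) *m (col_base M *m row_base M)).
    by rewrite !mulmxA.
  by rewrite !mulmx_base MM.
by rewrite -[in LHS](mulmx_base M) mxtrace_mulC RC mxtrace1.
Qed.

Lemma orthoprojector_compl : orthoprojector (1%:M - M).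
Proof.
have [MT MM] := hM; split; first by rewrite linearB/= trmx1 MT.
by rewrite mulmxBr mulmx1 mulmxBl mul1mx MM subrr subr0.
Qed.

End orthoprojectors.

Section projector_comparison.
Context {R : realType} {n : nat} (M : 'M[R]_n).
Hypothesis hM : orthoprojector M.
Local Open Scope ereal_scope.
Notation mR := (measurableTypeR R).
Notation cols := [seq col i M | i <- index_enum 'I_n].

Lemma gauss_avgs_orthoprojector (H : mR -> \bar R) : measurable_fun setT H ->
  (forall s, 0 <= H s) ->
  gauss_avgs cols (fun v => H (dot v v)) 0%R =
  \int[chi_square_prob R (\rank M)]_s H s.
Proof.
move=> mH H0; have [_ MM] := hM.
rewrite (@gauss_avgs_chi_square _ _ _ (\rank M))//.
- by apply: eq_integral => s _; rewrite /dot mulmx0 mxE add0r.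
- by rewrite gram_col_orthoprojector.
- by rewrite gram_col_orthoprojector// mxtrace_orthoprojector.
- by rewrite mulmx0.
Qed.

Lemma chi_square_mean : \int[chi_square_prob R (\rank M)]_s (Num.sqrt s ^+ 2)%:E =
  (\rank M)%:R%:E.
Proof.
rewrite -(gauss_avgs_orthoprojector (H := fun s => (Num.sqrt s ^+ 2)%:E)).
- under [X in gauss_avgs _ X]funext => v do rewrite sqr_sqrtr ?dot_ge0//.
  rewrite gauss_avgs_square -mxtrace_gram gram_col_orthoprojector//.
  by rewrite mxtrace_orthoprojector// /dot mulmx0 mxE add0r.
- apply/measurable_EFinP; apply: measurable_funX.
  by apply: continuous_measurable_fun; exact: sqrt_continuous.
- by move=> s; rewrite lee_fin sqr_ge0.
Qed.

Context d (T : measurableType d) (P : probability T R)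
  (eta : 'I_n -> {RV P >-> R}).
Context (ind_eta : mutually_independent eta)
  (eta_mean : forall i, ('E_P[eta i] = 0)%E)
  (eta_le1 : forall i, {ae P, forall w, (`|eta i w| <= 1)%R}).

Lemma quad_form_le_gauss_avgs (H : R -> \bar R) :
  two_point (fun v : 'cV[R]_n => H (dot v v)) ->
  \int[P]_w H (quad_form M (\col_i eta i w)) <=
    gauss_avgs cols (fun v => H (dot v v)) 0%R.
Proof.
move=> tH.
under eq_integral do rewrite (quad_form_orthoprojector hM) mulmx_col_sum.
apply: (@integral_sum_le _ _ _ P n n eta (fun i => col i M) ind_eta eta_mean
  eta_le1 _ (fun v => H (dot v v))) => //.
exact: index_enum_uniq.
Qed.

Lemma quad_form_mean_le :
  \int[P]_w (quad_form M (\col_i eta i w))%:E <= (\rank M)%:R%:E.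
Proof.
apply: le_trans (quad_form_le_gauss_avgs (@two_point_square R n)) _.
rewrite gauss_avgs_square -mxtrace_gram gram_col_orthoprojector//.
by rewrite mxtrace_orthoprojector// /dot mulmx0 mxE add0r.
Qed.

Lemma measurable_quad_form :
  measurable_fun setT (fun w => quad_form M (\col_i eta i w)).
Proof.
apply/measurable_EFinP.
under eq_fun do rewrite (quad_form_orthoprojector hM) mulmx_col_sum.
apply: (@borel_square R n); apply: (@coord_measurable_sum _ _ _ _ _ _ eta _ _ T id).
by move=> i _; exact: measurable_funP.
Qed.

End projector_comparison.

Section chi_square_integral.
Context d (T : measurableType d) (R : realType) (P : probability T R) (r : nat)
  (X : {RV P >-> R}).
Hypothesis hX : chi_square_distributed r X.
Local Open Scope ereal_scope.

Lemma ge0_integral_chi_square (H : measurableTypeR R -> \bar R) :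
  measurable_fun setT H -> (forall s, 0 <= H s) ->
  \int[P]_w H (X w) = \int[chi_square_prob R r]_s H s.
Proof.
move=> mH H0.
have mX : measurable_fun setT (X : T -> measurableTypeR R).
  by move=> _ A mA; rewrite setTI; exact: (measurable_funPTI X mA).
pose X' : {mfun T >-> measurableTypeR R} :=
  HB.pack (X : T -> measurableTypeR R) (isMeasurableFun.Build _ _ _ _ _ mX).
rewrite -[LHS](@ge0_integral_distribution _ _ _ _ _ P X')//.
by apply: eq_measure_integral => A mA _; exact: hX.
Qed.

End chi_square_integral.

Section comparison.
Context (R : realType) (n : nat) (M : 'M[R]_n) (hM : orthoprojector M)
  (dX : measure_display) (TX : measurableType dX) (PX : probability TX R)
  (X : {RV PX >-> R}) (hX : chi_square_distributed (\rank M) X).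
Context d (T : measurableType d) (P : probability T R)
  (eta : 'I_n -> {RV P >-> R}).
Context (ind_eta : mutually_independent eta)
  (eta_mean : forall i, ('E_P[eta i] = 0)%E)
  (eta_le1 : forall i, {ae P, forall w, (`|eta i w| <= 1)%R}).
Local Open Scope ereal_scope.

Lemma C2_up_quad_form_le (f : R -> R) : C2_up_conv f ->
  \int[P]_w (f (Num.sqrt (quad_form M (\col_i eta i w))))%:E <=
  \int[PX]_w (f (Num.sqrt (X w)))%:E.
Proof.
move=> cf; have tf := C2_up_two_point n cf.
have [/C2_conv_measurable mf _ _] := cf.
pose H (s : R) := (f (Num.sqrt s))%:E.
have mH : measurable_fun setT H.
  apply/measurable_EFinP; apply: (measurableT_comp mf).
  by apply: continuous_measurable_fun; exact: sqrt_continuous.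
have H0 s : 0 <= H s.
  by rewrite lee_fin (C2_up_ge0 cf)// sqrtr_ge0.
rewrite [leRHS](ge0_integral_chi_square hX (H := H))//.
rewrite -gauss_avgs_orthoprojector//.
exact: (quad_form_le_gauss_avgs hM ind_eta eta_mean eta_le1 (H := H)).
Qed.

(** For signs the forms of [M] and of the complementary projector add up to [n],
    and the mean of the latter is at most its rank [n - \rank M]. *)
Lemma rank_le_quad_form_mean :
  (forall i, {ae P, forall w, (`|eta i w| = 1)%R}) ->
  (\rank M)%:R%:E <= \int[P]_w (quad_form M (\col_i eta i w))%:E.
Proof.
move=> eta1.
have hN := orthoprojector_compl hM.
have le := quad_form_mean_le hN ind_eta eta_mean eta_le1.
have mq := measurable_quad_form hM eta.
have mqN := measurable_quad_form hN eta.
have q0 (N : 'M[R]_n) : orthoprojector N -> forall w, 0 <= (quad_form N (\col_i eta i w))%:E.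
  by move=> hN' w; rewrite (quad_form_orthoprojector hN') lee_fin dot_ge0.
have sumE : \int[P]_w (quad_form M (\col_i eta i w))%:E +
    \int[P]_w (quad_form (1%:M - M) (\col_i eta i w))%:E = n%:R%:E.
  rewrite -ge0_integralD//; last 4 first.
  - by move=> w _; exact: q0.
  - exact/measurable_EFinP.
  - by move=> w _; exact: q0.
  - exact/measurable_EFinP.
  rewrite -[RHS](integral_probability_cst P); apply: ae_eq_integral => //.
  - by apply: emeasurable_funD; exact/measurable_EFinP.
  have : \forall w \ae P, forall i, (`|eta i w| = 1)%R.
    exact: filter_forall.
  apply: filterS => w h _; rewrite -EFinD; congr EFin.
  transitivity (dot (\col_i eta i w) (\col_i eta i w)).
    rewrite /quad_form /dot mulmxBr mulmx1 mulmxBl.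
    by rewrite [X in (_ + X)%R]mxE [X in (_ + (_ + X))%R]mxE addrC subrK.
  rewrite dotE (eq_bigr (fun=> 1%R)) ?sumr_const ?card_ord// => i _.
  by rewrite !mxE -expr2 -real_normK ?num_real// h expr1n.
have rkN : ((\rank (1%:M - M)%R)%:R = n%:R - (\rank M)%:R :> R)%R.
  by rewrite -!mxtrace_orthoprojector// linearB/= mxtrace1.
have b0 : 0 <= \int[P]_w (quad_form (1%:M - M)%R (\col_i eta i w))%:E.
  by apply: integral_ge0 => w _; exact: q0.
move: le sumE b0; rewrite rkN.
move: (\int[P]_w (quad_form (1%:M - M)%R _)%:E) => [b||] //.
move: (\int[P]_w (quad_form M _)%:E) => [a||] //.
by rewrite -EFinD !lee_fin => ble [] abE; lra.
Qed.

End comparison.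

Section quadratic_part.
Context d (T : measurableType d) (R : realType) (P : probability T R).
Local Open Scope ereal_scope.

(** The integral of [f \o Y] may be infinite; only the quadratic part is
    integrable. *)
Lemma integral_quadratic_shift (f : R -> R) (c e k : R) (Y : T -> R) :
  measurable_fun setT Y -> (forall w, (0 <= Y w)%R) ->
  measurable_fun setT f ->
  (forall y, (0 <= y)%R -> (0 <= f y - e - c * y ^+ 2)%R) ->
  \int[P]_w (Y w ^+ 2)%:E = k%:E ->
  \int[P]_w (f (Y w))%:E =
  \int[P]_w (f (Y w) - e - c * Y w ^+ 2)%:E + (e + c * k)%:E.
Proof.
move=> mY Y0 mf fge kE.
have mY2 : measurable_fun setT (fun w => (Y w ^+ 2)%:E).
  by apply/measurable_EFinP; exact: measurable_funX.
have iY2 : P.-integrable setT (EFin \o (fun w => Y w ^+ 2)%R).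
  apply/integrableP; split => //.
  under eq_integral do rewrite gee0_abs ?lee_fin ?sqr_ge0//.
  by rewrite kE ltry.
have icY2 : P.-integrable setT (fun w => c%:E * (Y w ^+ 2)%:E) by exact: integrableZl.
have ie : P.-integrable setT (fun _ : T => e%:E).
  exact: finite_measure_integrable_cst.
have iq : P.-integrable setT (EFin \o (fun w => e + c * Y w ^+ 2)%R).
  rewrite (_ : _ \o _ = (fun w => e%:E + c%:E * (Y w ^+ 2)%:E)); last first.
    by apply/funext => w /=; rewrite EFinD EFinM.
  exact: integrableD.
have mfY : measurable_fun setT (fun w => f (Y w)) by exact: (measurableT_comp mf).
have -> : \int[P]_w (f (Y w))%:E =
    \int[P]_w ((f (Y w) - e - c * Y w ^+ 2) + (e + c * Y w ^+ 2))%:E.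
  by apply: eq_integral => w _; congr EFin; ring.
rewrite (ge0_integralD_integrable (g := fun w => f (Y w) - e - c * Y w ^+ 2)%R)//.
- congr (_ + _); under eq_integral do rewrite EFinD EFinM.
  by rewrite integralD// integralZl// kE (integral_probability_cst P).
- apply: measurable_funB; first exact: measurable_funB.
  by apply: measurable_funM => //; exact: measurable_funX.
- by move=> w; exact: fge.
Qed.

Lemma rademacher_abs (X : {RV P >-> R}) : rademacher X ->
  {ae P, forall w, (`|X w| = 1)%R}.
Proof.
move=> [X1 XN1].
have m1 : measurable (X @^-1` [set 1%R]) by exact: measurable_funPTI.
have mN1 : measurable (X @^-1` [set (- 1)%R]) by exact: measurable_funPTI.
exists (~` (X @^-1` [set 1%R] `|` X @^-1` [set (- 1)%R])); split.
- by apply: measurableC; exact: measurableU.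
- rewrite probability_setC; last exact: measurableU.
  have half2 : (2^-1 + 2^-1 = 1 :> R)%R by field.
  have disj : X @^-1` [set 1%R] `&` X @^-1` [set (- 1)%R] = set0.
    apply/seteqP; split => // w /= [-> /eqP]; rewrite -subr_eq0 opprK.
    by rewrite (_ : 1 + 1 = 2)%R ?pnatr_eq0//.
  have -> := measureU P m1 mN1 disj.
  move: X1 XN1 => /= -> ->; rewrite -EFinD half2.
  by rewrite -[LHS]/(1%:E - 1%:E) subee.
- move=> w /= Xw [] Xw'; apply: Xw; rewrite Xw' ?normrN normr1//.
Qed.

Lemma rademacher_mean (X : {RV P >-> R}) : rademacher X -> 'E_P[X] = 0.
Proof.
move=> rX; have [X1 XN1] := rX; rewrite unlock.
have m1 : measurable (X @^-1` [set 1%R]) by exact: measurable_funPTI.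
have i1 : P.-integrable setT (EFin \o \1_(X @^-1` [set 1%R])).
  by apply: integrable_indic => //; rewrite -ge0_fin_numE// fin_num_measure.
transitivity (\int[P]_w (2%:E * (\1_(X @^-1` [set 1%R]) w)%:E + (-1)%:E)).
  apply: ae_eq_integral => //.
  - exact/measurable_EFinP.
  - apply: emeasurable_funD => //; apply: measurable_funeM.
    by apply/measurable_EFinP; exact: measurable_indic.
  - apply: filterS (rademacher_abs rX) => w h _.
    rewrite -EFinM -EFinD indicE; congr EFin.
    have [Xw|Xw] := eqVneq (X w) 1%R.
      by rewrite mem_set//= Xw; ring.
    rewrite memNset/=; last by apply/eqP.
    have -> : X w = (- 1)%R.
      move: h Xw; have [_ ->|_ h _] := ger0P (X w); first by rewrite eqxx.
      by rewrite -[LHS]opprK h.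
    by ring.
rewrite integralD//; last 2 first.
- exact: integrableZl.
- exact: finite_measure_integrable_cst.
rewrite integralZl//.
rewrite integral_indic// setIT (integral_probability_cst P).
move: X1 => /= ->.
by rewrite -EFinM -EFinD; congr EFin; field.
Qed.

End quadratic_part.

Theorem corollary4p3 (R : realType) (n : nat) (M : 'M[R]_n)
    (hM : orthoprojector M) (r : nat) (hr : r = \rank M)
    (dX : measure_display) (TX : measurableType dX) (PX : probability TX R)
    (X : {RV PX >-> R}) (hX : chi_square_distributed r X) :
  (forall (d : measure_display) (T : measurableType d) (P : probability T R)
      (eps : 'I_n -> {RV P >-> R}),
    mutually_independent eps ->
    (forall i, rademacher (eps i)) ->
    forall f : R -> R, C2_conv f ->
      ('E_P[fun w => f (Num.sqrt (quad_form M (\col_i eps i w)))]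
        <= 'E_PX[fun w => f (Num.sqrt (X w))])%E) /\
  (forall f : R -> R, C2_up_conv f ->
    forall (d : measure_display) (T : measurableType d) (P : probability T R)
      (eta : 'I_n -> {RV P >-> R}),
    mutually_independent eta ->
    (forall i, 'E_P[eta i] = 0)%E ->
    (forall i, {ae P, forall w, `|eta i w| <= 1}) ->
      ('E_P[fun w => f (Num.sqrt (quad_form M (\col_i eta i w)))]
        <= 'E_PX[fun w => f (Num.sqrt (X w))])%E).
Proof.
subst r; split; last first.
  move=> f cf d T P eta ind_eta eta0 eta1; rewrite unlock.
  exact: (C2_up_quad_form_le hM hX ind_eta eta0 eta1 cf).
move=> d T P eps ind_eps rad f cf; rewrite unlock.
have eps0 i := rademacher_mean (rad i).
have eps1 i := rademacher_abs (rad i).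
have eps_le1 i : {ae P, forall w, `|eps i w| <= 1}.
  by apply: filterS (eps1 i) => w ->.
have [c c0 cg] := C2_conv_split cf.
have mf := C2_conv_measurable cf.
have cmp := C2_up_quad_form_le hM hX ind_eps eps0 eps_le1 cg.
have sq_le := quad_form_mean_le hM ind_eps eps0 eps_le1.
have sq_ge := rank_le_quad_form_mean hM ind_eps eps0 eps_le1 eps1.
have sqE : (\int[P]_w (quad_form M (\col_i eps i w))%:E = (\rank M)%:R%:E)%E.
  by apply/eqP; rewrite eq_le sq_le sq_ge.
have msqrt : measurable_fun [set: R] (@Num.sqrt R).
  by apply: continuous_measurable_fun; exact: sqrt_continuous.
have g0 y : 0 <= y -> 0 <= f y - f 0 - c * y ^+ 2 
  by exact: (@C2_up_ge0 _ _ cg y).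
rewrite (integral_quadratic_shift (c := c) (e := f 0) (k := (\rank M)%:R)
  (Y := fun w => Num.sqrt (quad_form M (\col_i eps i w))))//.
rewrite (integral_quadratic_shift (c := c) (e := f 0) (k := (\rank M)%:R)
  (Y := fun w => Num.sqrt (X w)))//.
- by rewrite leeD2rE.
- by apply: (measurableT_comp msqrt); exact: measurable_funP.
- rewrite -(chi_square_mean hM).
  apply: (ge0_integral_chi_square hX (H := fun s => (Num.sqrt s ^+ 2)%:E)).
    by apply/measurable_EFinP; exact: measurable_funX.
  by move=> s; rewrite lee_fin sqr_ge0.
- by apply: (measurableT_comp msqrt); exact: measurable_quad_form.
- rewrite -sqE; apply: eq_integral => w _.
  by rewrite sqr_sqrtr// (quad_form_orthoprojector hM) dot_ge0.
Qed.
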